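(* Let $(M,F)$ be an $n$-dimensional complex Finsler space. The following assertions are equivalent: i) $(M,F)$ is a strong Landsberg space, i.e. $C_{l\bar rh\overset{B}{|}0}=0$ and $C_{j\bar rh\overset{B}{|}\bar 0}=0$; ii) the functions $g_{l\bar r\overset{B}{|}s}$ depend only on $z$, and $\dot\partial_{\bar h}G^i=0$; iii) $C_{l\bar rh\overset{B}{|}k}=0$ and $\dot\partial_{\bar h}G^i=0$; iv) $C_{j\bar rh\overset{B}{|}\bar k}=0$. (All identities are required for all values of the free indices and at all points of $\widetilde{T'M}$.)
   Context: Let $M$ be an $n$-dimensional complex manifold, $T'M$ its holomorphic tangent bundle with local coordinates $(z^k,\eta^k)$, and $\widetilde{T'M}=T'M\setminus\{0\}$ (zero section removed). A complex Finsler space $(M,F)$ is given by a continuous $F:T'M\to[0,\infty)$ with: $L:=F^2$ smooth on $\widetilde{T'M}$; $F(z,\eta)=0$ iff $\eta=0$; $F(z,\lambda\eta)=|\lambda|F(z,\eta)$ for $\lambda\in\mathbb C$; and the Hermitian matrix $g_{i\bar j}:=\partial^2L/\partial\eta^i\partial\bar\eta^j$ positive definite. $(g^{\bar j i})$ is the inverse matrix, $g^{\bar j i}g_{k\bar j}=\delta^i_k$. Notation: $\dot\partial_k=\partial/\partial\eta^k$, $\dot\partial_{\bar k}=\partial/\partial\bar\eta^k$; summation convention. Cartan tensors: $C_{i\bar jk}=\dot\partial_kg_{i\bar j}$, $C_{i\bar j\bar k}=\dot\partial_{\bar k}g_{i\bar j}$. Set $N^i_j:=g^{\bar mi}\frac{\partial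 g_{l\bar m}}{\partial z^j}\eta^l$, spray coefficients $G^i:=\tfrac12N^i_j\eta^j$, $\overset{c}{N}{}^i_j:=\dot\partial_jG^i$, $\overset{c}{\delta}_k:=\frac{\partial}{\partial z^k}-\overset{c}{N}{}^j_k\dot\partial_j$, and $\overset{c}{\delta}_{\bar k}$ its conjugate. Berwald coefficients: $\overset{B}{L}{}^i_{jk}:=\dot\partial_k\overset{c}{N}{}^i_j$, $\overset{B}{L}{}^i_{j\bar k}:=\dot\partial_{\bar k}\overset{c}{N}{}^i_j$. Barred-index coefficients are conjugates: $\overset{B}{L}{}^{\bar\imath}_{\bar jk}=\overline{\overset{B}{L}{}^i_{j\bar k}}$, $\overset{B}{L}{}^{\bar\imath}_{\bar j\bar k}=\overline{\overset{B}{L}{}^i_{jk}}$. The $h$-covariant derivative with respect to the Berwald connection, $\overset{B}{|}k$, of a tensor with lower indices applies $\overset{c}{\delta}_k$ and subtracts a term $\overset{B}{L}{}^l_{ik}$ for each unbarred lower index $i$ and $\overset{B}{L}{}^{\bar m}_{\bar jk}$ for each barred lower index $\bar j$; e.g. $g_{i\bar j\overset{B}{|}k}=\overset{c}{\delta}_kg_{i\bar j}-\overset{B}{L}{}^l_{ik}g_{l\bar j}-\overset{B}{L}{}^{\bar m}_{\bar jk}g_{i\bar m}$. The $\bar h$-covariant derivative $\overset{B}{|}\bar k$ similarly uses $\overset{c}{\delta}_{\bar k}$, $\overset{B}{L}{}^l_{i\bar k}$ and $\overset{B}{L}{}^{\bar m}_{\bar j\bar k}$. An index $0$ (resp. $\bar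 0$) means contraction with $\eta$ (resp. $\bar\eta$): $C_{l\bar rh\overset{B}{|}0}=C_{l\bar rh\overset{B}{|}k}\eta^k$, $C_{j\bar rh\overset{B}{|}\bar 0}=C_{j\bar rh\overset{B}{|}\bar k}\bar\eta^k$. *)

(* Defs.v *)
From HB Require Import structures.
From mathcomp Require Import all_boot all_order all_algebra.
From mathcomp Require Import all_classical all_reals all_analysis.
From mathcomp Require Import complex.

Set Implicit Arguments.
Unset Strict Implicit.
Unset Printing Implicit Defensive.

Import Order.TTheory GRing.Theory Num.Theory.
Import numFieldNormedType.Exports.

Local Open Scope ring_scope.
Local Open Scope classical_set_scope.

(* The complex numbers over R.  Naming them as a [numClosedFieldType] lets the
   topology and the norm that the library gives to every [numFieldType] be
   inferred; they are not attached to [R[i]] itself. *)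
Definition Cplx (R : realType) : numClosedFieldType := R[i].

Definition ofR (R : realType) (x : R) : Cplx R := @Complex R x 0.

Section calculus.
Variable R : realType.
Local Notation C := (Cplx R).
Variable V : normedModType C.
Implicit Types (f : V -> C) (v p : V).

Definition re_line f v p (t : R) : R := complex.Re (f (p + ofR t *: v)).
Definition im_line f v p (t : R) : R := complex.Im (f (p + ofR t *: v)).

Definition rderivable v f p : Prop :=
  derivable (re_line f v p) 0 1 /\ derivable (im_line f v p) 0 1.

(* Derivative of f in the direction v with respect to a real parameter;
   the derivative [derive] of the library would only admit V over C, that is,
   a complex parameter. *)
Definition rderive v f p : C :=
  @Complex R ((re_line f v p)^`() 0) ((im_line f v p)^`() 0).

(* f is of class C^m, in the real sense, on the open set O. *)
Fixpoint Cclass (m : nat) (O : set V) f : Prop :=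
  (forall p, O p -> {for p, continuous f}) /\
  (if m is m'.+1 then
     forall v, (forall p, O p -> rderivable v f p) /\
               Cclass m' O (rderive v f)
   else True).

Definition smooth_on (O : set V) f : Prop := forall m, Cclass m O f.

(* Wirtinger derivatives: for v the unit vector of the complex coordinate
   x + iy, [rderive v] is d/dx and [rderive ('i *: v)] is d/dy. *)
Definition wirtinger v f p : C :=
  2^-1 * (rderive v f p - 'i * rderive ('i *: v) f p).
Definition wirtinger_bar v f p : C :=
  2^-1 * (rderive v f p + 'i * rderive ('i *: v) f p).

End calculus.

Record complexManifold (R : realType) (n : nat) := ComplexManifold {
  cm_space :> topologicalType;
  cm_hausdorff : hausdorff_space cm_space;
  cm_countable : @second_countable cm_space;
  cm_index : Type;
  cm_dom : cm_index -> set cm_space;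
  cm_chart : cm_index -> cm_space -> 'rV[Cplx R]_n;
  cm_inv : cm_index -> 'rV[Cplx R]_n -> cm_space;
  cm_dom_open : forall a, open (cm_dom a);
  cm_cover : forall p, exists a, cm_dom a p;
  cm_img_open : forall a, open (cm_chart a @` cm_dom a);
  cm_chartK : forall a p, cm_dom a p -> cm_inv a (cm_chart a p) = p;
  cm_chart_continuous : forall a p, cm_dom a p ->
    {for p, continuous (cm_chart a)};
  cm_inv_continuous : forall a z, (cm_chart a @` cm_dom a) z ->
    {for z, continuous (cm_inv a)};
  (* [differentiable] is over the field C, so this says holomorphic. *)
  cm_holomorphic : forall a b z, (cm_chart a @` (cm_dom a `&` cm_dom b)) z ->
    differentiable (cm_chart b \o cm_inv a) z
}.

Section tangent_bundle.
Variables (R : realType) (n : nat) (M : complexManifold R n).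
Local Notation C := (Cplx R).

Definition cm_img (a : cm_index M) : set 'rV[C]_n := cm_chart a @` cm_dom a.

(* A holomorphic tangent vector at p is represented by all its component
   vectors: the pairs (b, w) with w its components in the chart b around p.
   Here v gives the components in the chart a. *)
Definition tangent_comps (a : cm_index M) (p : M) (v : 'rV[C]_n) :
    set (cm_index M * 'rV[C]_n) :=
  [set bw | cm_dom bw.1 p /\
     bw.2 = 'd (cm_chart bw.1 \o cm_inv a) (cm_chart a p) v].

Record tangent := Tangent {
  t_base : M;
  t_comps : set (cm_index M * 'rV[C]_n);
  t_compsP : exists a v,
    cm_dom a t_base /\ t_comps = tangent_comps a t_base v
}.

Definition mk_tangent (a : cm_index M) (p : M) (ap : cm_dom a p)
    (v : 'rV[C]_n) : tangent :=
  @Tangent p (tangent_comps a p v)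
    (ex_intro _ a (ex_intro _ v (conj ap erefl))).

(* The expression of F in the local coordinates (z, eta) of T'M induced by the
   chart a.  It is meaningful for z in [cm_img a], and only used there. *)
Definition local_fun (F : tangent -> R) (a : cm_index M)
    (q : 'rV[C]_n * 'rV[C]_n) : R :=
  match pselect (cm_dom a (cm_inv a q.1)) with
  | left ap => F (mk_tangent ap q.2)
  | right _ => 0
  end.

Definition local_T (a : cm_index M) : set ('rV[C]_n * 'rV[C]_n) :=
  [set q | cm_img a q.1].
Definition local_slit_T (a : cm_index M) : set ('rV[C]_n * 'rV[C]_n) :=
  [set q | cm_img a q.1 /\ q.2 != 0].

Definition local_L (F : tangent -> R) (a : cm_index M)
    (q : 'rV[C]_n * 'rV[C]_n) : C := ofR (local_fun F a q ^+ 2).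

End tangent_bundle.

Section local_geometry.
Variables (R : realType) (n : nat).
Local Notation C := (Cplx R).
Local Notation TC := ('rV[C]_n * 'rV[C]_n)%type.
Implicit Types (i j k l m r h : 'I_n) (f : TC -> C) (q : TC).

Definition d_z k : (TC -> C) -> TC -> C := wirtinger (delta_mx 0 k, 0).
Definition d_zbar k : (TC -> C) -> TC -> C := wirtinger_bar (delta_mx 0 k, 0).
Definition d_eta k : (TC -> C) -> TC -> C := wirtinger (0, delta_mx 0 k).
Definition d_etabar k : (TC -> C) -> TC -> C :=
  wirtinger_bar (0, delta_mx 0 k).

Variable L : TC -> C.

(* g_{i jbar} *)
Definition metric i j : TC -> C := d_eta i (d_etabar j L).

(* g^{jbar i}: with rows j and columns i this is the inverse of the matrix
   of the g_{k jbar} with rows k and columns j. *)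
Definition inv_metric j i q : C :=
  invmx (\matrix_(k, j') metric k j' q) j i.

(* C_{i jbar k} *)
Definition cartan i j k : TC -> C := d_eta k (metric i j).

(* N^i_j *)
Definition cf_connection i j q : C :=
  \sum_m \sum_l inv_metric m i q * d_z j (metric l m) q * q.2 0 l.

(* G^i *)
Definition spray i q : C := 2^-1 * \sum_j cf_connection i j q * q.2 0 j.

(* The canonical connection Nc^i_j *)
Definition c_connection i j : TC -> C := d_eta j (spray i).

Definition c_delta k f q : C :=
  d_z k f q - \sum_j c_connection j k q * d_eta j f q.
Definition c_deltabar k f q : C :=
  d_zbar k f q - \sum_j (c_connection j k q)^* * d_etabar j f q.

(* L^i_{jk}, L^i_{j kbar}, L^ibar_{jbar k} and L^ibar_{jbar kbar} *)
Definition berwald i j k : TC -> C := d_eta k (c_connection i j).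
Definition berwald_ub i j k : TC -> C := d_etabar k (c_connection i j).
Definition berwald_bu i j k q : C := (berwald_ub i j k q)^*.
Definition berwald_bb i j k q : C := (berwald i j k q)^*.

(* g_{i jbar | k} *)
Definition metric_h i j k q : C :=
  c_delta k (metric i j) q
  - \sum_l berwald l i k q * metric l j q
  - \sum_m berwald_bu m j k q * metric i m q.

(* C_{l rbar h | k} *)
Definition cartan_h l r h k q : C :=
  c_delta k (cartan l r h) q
  - \sum_m berwald m l k q * cartan m r h q
  - \sum_m berwald_bu m r k q * cartan l m h q
  - \sum_m berwald m h k q * cartan l r m q.

(* C_{j rbar h | kbar} *)
Definition cartan_hbar j r h k q : C :=
  c_deltabar k (cartan j r h) q
  - \sum_m berwald_ub m j k q * cartan m r h q
  - \sum_m berwald_bb m r k q * cartan j m h q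
  - \sum_m berwald_ub m h k q * cartan j r m q.

(* C_{l rbar h | 0} and C_{j rbar h | 0bar} *)
Definition cartan_h0 l r h q : C := \sum_k cartan_h l r h k q * q.2 0 k.
Definition cartan_hbar0 j r h q : C :=
  \sum_k cartan_hbar j r h k q * (q.2 0 k)^*.

End local_geometry.

Record complexFinslerSpace (R : realType) (n : nat) := ComplexFinslerSpace {
  cf_manifold :> complexManifold R n;
  cf_metric : tangent cf_manifold -> R;
  cf_ge0 : forall v, 0 <= cf_metric v;
  cf_continuous : forall (a : cm_index cf_manifold) q, local_T a q ->
    {for q, continuous (local_fun cf_metric a)};
  cf_smooth : forall a : cm_index cf_manifold,
    smooth_on (local_slit_T a) (local_L cf_metric a);
  cf_eq0 : forall (a : cm_index cf_manifold) z eta, local_T a (z, eta) ->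
    (local_fun cf_metric a (z, eta) = 0 <-> eta = 0);
  cf_homogeneous : forall (a : cm_index cf_manifold) z eta (c : Cplx R),
    local_T a (z, eta) ->
    ofR (local_fun cf_metric a (z, c *: eta)) =
    `|c| * ofR (local_fun cf_metric a (z, eta));
  cf_posdef : forall (a : cm_index cf_manifold) q, local_slit_T a q ->
    forall xi : 'rV[Cplx R]_n, xi != 0 ->
    0 < \sum_i \sum_j
          metric (local_L cf_metric a) i j q * xi 0 i * (xi 0 j)^*
}.

Definition cf_L (R : realType) (n : nat) (M : complexFinslerSpace R n)
    (a : cm_index M) : 'rV[Cplx R]_n * 'rV[Cplx R]_n -> Cplx R :=
  local_L (@cf_metric R n M) a.

Definition strong_landsberg (R : realType) (n : nat)
    (M : complexFinslerSpace R n) : Prop :=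
  (forall (a : cm_index M) q (l r h : 'I_n), local_slit_T a q ->
     cartan_h0 (cf_L a) l r h q = 0) /\
  (forall (a : cm_index M) q (j r h : 'I_n), local_slit_T a q ->
     cartan_hbar0 (cf_L a) j r h q = 0).

(* Main.v *)
Require Import Defs.
From HB Require Import structures.
From mathcomp Require Import all_boot all_order all_algebra.
From mathcomp Require Import all_classical all_reals all_analysis.
From mathcomp Require Import complex.
From mathcomp Require Import ring lra.
Import Order.TTheory GRing.Theory Num.Theory.
Import numFieldNormedType.Exports.
Set Implicit Arguments.
Unset Strict Implicit.
Unset Printing Implicit Defensive.
Local Open Scope ring_scope.
Local Open Scope classical_set_scope.

(* The proof works in one chart, on the tangent vectors eta <> 0.  By Euler's
   relations, C_{j rbar h | 0bar} contracted with etabar^r is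
   2 (d Gbar^m / d eta^h) g_{j mbar}, so each of the four assertions forces G to
   be holomorphic in eta.  The mixed Berwald coefficients then vanish, and the
   L^i_{jk}, being holomorphic and homogeneous of degree 0 in eta, do not depend
   on eta.  Hence f_s := g_{l rbar | s} satisfies d f_s / d eta^h = C_{l rbar h | s}
   and d f_s / d etabar^h = conj C_{r lbar h | sbar}.  As f_s is homogeneous of
   degree 0, it depends only on z as soon as one of these two derivatives
   vanishes, which gives ii => iii => iv => i.  Under i, phi := f_s eta^s has
   d phi / d eta^h = f_h and d phi / d etabar^k = 0, so that
   d f_h / d etabar^k = d^2 phi / d eta^h d etabar^k = 0, which gives ii.

   A holomorphic function of degree 0 on C^n minus the origin is constant: its
   derivatives phi have degree -1, and at a maximum p of |eta|^2 |phi|^2 on the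
   unit sphere the second derivative test in a complex direction orthogonal to p
   forces phi(p) = 0. *)

(** Smoothness means here that iterated real directional derivatives exist and are continuous.
    Linearity in the direction and commutation of derivatives are therefore theorems, both drawn
    from the mean value theorem; expansions of Wirtinger derivatives in components rest on the
    former, every exchange of derivatives on the latter.

    The spray is differentiated without differentiating the inverse metric: lowering its index gives
    2 G^i g_{i mbar} = (d^2 L / dz^j d etabar^m) eta^j. The conjugate of this identity,
    differentiated in eta^h, is what C_{j rbar h | 0bar} etabar^r is compared with.

    In |eta|^2 |phi|^2 the factor |eta|^2 makes the degree 0, so a maximum on the sphere is one on
    the whole slit fibre and can be tested along straight lines. An orthogonal direction exists only
    for n >= 2; for n = 1 Euler's relation takes its place.

    The two halves of i have separate roles for phi = f_s eta^s: the first removes the terms C_{l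
    rbar h | s} eta^s from d phi / d eta^h, the second is the vanishing of d phi / d etabar^k. *)

Section complex_numbers.
Variable R : realType.
Local Notation C := (Cplx R).
Implicit Types (x y : C) (s t : R).

Lemma cplxP x y :
  complex.Re x = complex.Re y -> complex.Im x = complex.Im y -> x = y.
Proof. by case: x y => a b [c d] /= -> ->. Qed.

Lemma ReD x y : complex.Re (x + y) = complex.Re x + complex.Re y.
Proof. by case: x y => a b [c d]. Qed.

Lemma ImD x y : complex.Im (x + y) = complex.Im x + complex.Im y.
Proof. by case: x y => a b [c d]. Qed.

Lemma ReN x : complex.Re (- x) = - complex.Re x.
Proof. by case: x. Qed.

Lemma ImN x : complex.Im (- x) = - complex.Im x.
Proof. by case: x. Qed.

Lemma ReM x y : complex.Re (x * y) =
  complex.Re x * complex.Re y - complex.Im x * complex.Im y.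
Proof. by case: x y => a b [c d]. Qed.

Lemma ImM x y : complex.Im (x * y) =
  complex.Re x * complex.Im y + complex.Im x * complex.Re y.
Proof. by case: x y => a b [c d]. Qed.

Lemma ReJ x : complex.Re x^* = complex.Re x.
Proof. by case: x. Qed.

Lemma ImJ x : complex.Im x^* = - complex.Im x.
Proof. by case: x. Qed.

Lemma cplx_iE : 'i = @Complex R 0 1 :> C.
Proof. by rewrite -[RHS]complexiE. Qed.

Lemma Re_i : complex.Re ('i : C) = 0. Proof. by rewrite cplx_iE. Qed.

Lemma Im_i : complex.Im ('i : C) = 1. Proof. by rewrite cplx_iE. Qed.

Definition ReIm := (ReD, ImD, ReN, ImN, ReM, ImM, ReJ, ImJ, Re_i, Im_i).

Lemma ofRD s t : ofR (s + t) = ofR s + ofR t.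
Proof. by apply: cplxP; rewrite ReIm //= addr0. Qed.

Lemma ofRM s t : ofR (s * t) = ofR s * ofR t.
Proof. by apply: cplxP; rewrite ReIm /= !(mulr0, mul0r, addr0, subr0). Qed.

Lemma ofR0 : ofR 0 = 0 :> C. Proof. by []. Qed.
Lemma ofR1 : ofR 1 = 1 :> C. Proof. by []. Qed.

Lemma norm_ofR t : `|ofR t| = ofR `|t|.
Proof. by rewrite normc_def /= expr0n addr0 sqrtr_sqr. Qed.

Lemma ltcR_ofR s t : (ofR s < ofR t) = (s < t).
Proof. exact: ltcR. Qed.

Lemma pos_ofR (e : C) : 0 < e -> e = ofR (complex.Re e) /\ 0 < complex.Re e.
Proof. by case: e => a b; rewrite ltcE /= => /andP[/eqP -> ->]. Qed.

Lemma normr_Re_le x : ofR `|complex.Re x| <= `|x|.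
Proof. exact: normc_ge_Re. Qed.

Lemma normr_Im_le x : ofR `|complex.Im x| <= `|x|.
Proof.
have := normc_ge_Re ('i * x).
by rewrite ReM Re_i Im_i mul0r sub0r mul1r normrN normrM normCi mul1r.
Qed.

Lemma continuous_ofR : continuous (@ofR R).
Proof.
move=> t; apply/cvgrPdist_lt => e /pos_ofR [-> e0].
have : \forall s \near t, `|t - s| < complex.Re e by exact: nbhsx_ballx.
apply: filterS => s ts.
have -> : ofR t - ofR s = ofR (t - s).
  by apply: cplxP; rewrite ReIm //= oppr0 addr0.
by rewrite norm_ofR ltcR_ofR.
Qed.

Lemma continuous_Re : continuous (@complex.Re R : C -> R).
Proof.
move=> x; apply/(@cvgrPdist_lt _ R C (nbhs x) (nbhs_filter x)) => e e0.
have : \forall y \near x, `|x - y| < ofR e.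
  by apply: nbhsx_ballx; rewrite -ofR0 ltcR_ofR.
apply: filterS => y xy.
by rewrite -ltcR_ofR -ReN -ReD; apply: le_lt_trans (normr_Re_le _) xy.
Qed.

Lemma continuous_Im : continuous (@complex.Im R : C -> R).
Proof.
move=> x; apply/(@cvgrPdist_lt _ R C (nbhs x) (nbhs_filter x)) => e e0.
have : \forall y \near x, `|x - y| < ofR e.
  by apply: nbhsx_ballx; rewrite -ofR0 ltcR_ofR.
apply: filterS => y xy.
by rewrite -ltcR_ofR -ImN -ImD; apply: le_lt_trans (normr_Im_le _) xy.
Qed.

Lemma continuous_conj : continuous (Num.conj : C -> C).
Proof.
move=> x; apply/(@cvgrPdist_lt _ C C (nbhs x) (nbhs_filter x)) => e e0.
have : \forall y \near x, `|x - y| < e by exact: nbhsx_ballx.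
by apply: filterS => y xy; rewrite -rmorphB norm_conjC.
Qed.

End complex_numbers.

(** * Real directional derivatives *)

Section real_derivative.
Variables (R : realType) (V : normedModType (Cplx R)).
Local Notation C := (Cplx R).
Implicit Types (f g : V -> C) (v p : V) (d e : C).

Lemma continuous_line p v : continuous (fun t : R => p + ofR t *: v).
Proof.
move=> t; apply: cvgD; first exact: cvg_cst.
apply: cvgZr_tmp; exact: continuous_ofR.
Qed.

Lemma line0 p v : p + ofR 0 *: v = p.
Proof. by rewrite ofR0 scale0r addr0. Qed.

Lemma near_line (O : set V) p v : open O -> O p ->
  \forall t \near (0 : R), O (p + ofR t *: v).
Proof.
move=> oO Op; have := @continuous_line p v 0; rewrite /continuous_at line0.
by apply; exact: open_nbhs_nbhs.
Qed.

(* Spelling out the structures gives 0 and 1 the instances they have in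
   [rderivable]; with other convertible ones unification becomes very slow. *)
Definition has_rderive f v p d :=
  @is_derive R R R 0 1 (re_line f v p) (complex.Re d) /\
  @is_derive R R R 0 1 (im_line f v p) (complex.Im d).

Lemma rderiveP f v p : rderivable v f p -> has_rderive f v p (rderive v f p).
Proof.
by case=> hr hi; split; rewrite /rderive /= derive1E;
  [apply/derivableP; exact hr|apply/derivableP; exact hi].
Qed.

Lemma has_rderivable f v p d : has_rderive f v p d -> rderivable v f p.
Proof. by case=> [[hr _] [hi _]]; exact: conj hr hi. Qed.

Lemma has_rderive_val f v p d : has_rderive f v p d -> rderive v f p = d.
Proof.
by case: d => a b [[_ /= hr] [_ /= hi]]; rewrite /rderive !derive1E hr hi.
Qed.

Lemma has_rderive_cst (c : C) v p : has_rderive (fun=> c) v p 0.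
Proof. by split; exact: is_derive_cst. Qed.

Lemma has_rderive_eq f v p d e : has_rderive f v p d -> d = e ->
  has_rderive f v p e.
Proof. by move=> + <-. Qed.

Lemma has_rderiveD f g v p d e : has_rderive f v p d -> has_rderive g v p e ->
  has_rderive (fun q => f q + g q) v p (d + e).
Proof.
move=> [fr fi] [gr gi]; split; rewrite !ReIm.
  have -> : re_line (fun q => f q + g q) v p = re_line f v p + re_line g v p.
    by apply/funext => t; rewrite /re_line ReD.
  exact: is_deriveD.
have -> : im_line (fun q => f q + g q) v p = im_line f v p + im_line g v p.
  by apply/funext => t; rewrite /im_line ImD.
exact: is_deriveD.
Qed.

Lemma re_line0 f v p : re_line f v p 0 = complex.Re (f p).
Proof. by rewrite /re_line line0. Qed.

Lemma im_line0 f v p : im_line f v p 0 = complex.Im (f p).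
Proof. by rewrite /im_line line0. Qed.

Lemma has_rderiveM f g v p d e : has_rderive f v p d -> has_rderive g v p e ->
  has_rderive (fun q => f q * g q) v p (d * g p + f p * e).
Proof.
rewrite /has_rderive.
have -> : re_line (fun q => f q * g q) v p =
    re_line f v p * re_line g v p - im_line f v p * im_line g v p.
  by apply/funext => t; rewrite /re_line /im_line ReM.
have -> : im_line (fun q => f q * g q) v p =
    re_line f v p * im_line g v p + im_line f v p * re_line g v p.
  by apply/funext => t; rewrite /re_line /im_line ImM.
rewrite !ReIm -!(re_line0 _ v) -!(im_line0 _ v).
move: (re_line f v p) (im_line f v p) (re_line g v p) (im_line g v p).
move: (complex.Re d) (complex.Im d) (complex.Re e) (complex.Im e).
move=> dr di er ei fr fi gr gi [dfr dfi] [dgr dgi].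
split.
  apply: is_derive_eq (is_deriveB (is_deriveM dfr dgr) (is_deriveM dfi dgi)) _.
  by rewrite /GRing.scale /=; ring.
apply: is_derive_eq (is_deriveD (is_deriveM dfr dgi) (is_deriveM dfi dgr)) _.
by rewrite /GRing.scale /=; ring.
Qed.

Lemma has_rderiveJ f v p d : has_rderive f v p d ->
  has_rderive (fun q => (f q)^*) v p d^*.
Proof.
move=> [fr fi]; split; rewrite !ReIm.
  have -> : re_line (fun q => (f q)^*) v p = re_line f v p => //.
  by apply/funext => t; rewrite /re_line ReJ.
have -> : im_line (fun q => (f q)^*) v p = - im_line f v p.
  by apply/funext => t; rewrite /im_line ImJ.
exact: is_deriveN.
Qed.

Lemma has_rderiveV f v p d : f p != 0 -> has_rderive f v p d ->
  has_rderive (fun q => (f q)^-1) v p (- d / (f p) ^+ 2).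
Proof.
move=> fp0 df.
(* 1 / f = conj f / N with N = f * conj f real, so only a real inverse is needed. *)
have fp0' : (f p)^* != 0 by rewrite conjC_eq0.
have [Nr Ni] := has_rderiveM df (has_rderiveJ df).
set N := fun q => _ in Nr Ni; set e := (X in complex.Re X) in Nr.
have Im0 (x : C) : x^* = x -> complex.Im x = 0.
  by case: x => a b [/eqP]; rewrite eqNr => /eqP.
have NE q : N q = ofR (complex.Re (N q)).
  by apply: cplxP => //=; apply: Im0; rewrite rmorphM /= conjCK mulrC.
have N0 : re_line N v p 0 != 0.
  rewrite /re_line line0; apply: contraNneq (mulf_neq0 fp0 fp0') => h.
  by rewrite -[_ * _]/(N p) NE h ofR0.
have eE : e = ofR (complex.Re e).
  apply: cplxP => //=; apply: Im0; rewrite /e !(rmorphD, rmorphM) /= !conjCK.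
  by ring.
have dNV : has_rderive (fun q => (N q)^-1) v p (- e / (N p) ^+ 2).
  have ofRV (s : R) : (ofR s)^-1 = ofR s^-1.
    have [->|s0] := eqVneq s 0; first by rewrite !(invr0, ofR0).
    have s0' : ofR s != 0 by apply: contra s0 => /eqP [->].
    by apply: (mulfI s0'); rewrite -ofRM !divff.
  have -> : - e / N p ^+ 2 = ofR (- (re_line N v p 0) ^- 2 * complex.Re e).
    rewrite {1}eE {1}NE /re_line line0 expr2 -ofRM ofRV.
    by apply: cplxP; rewrite ReIm /= -expr2; ring.
  split.
    have -> : re_line (fun q => (N q)^-1) v p = fun t => (re_line N v p t)^-1.
      by apply/funext => t; rewrite /re_line NE ofRV.
    exact: is_deriveV.
  have -> : im_line (fun q => (N q)^-1) v p = cst 0.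
    by apply/funext => t; rewrite /im_line NE ofRV.
  exact: is_derive_cst.
have -> : (fun q => (f q)^-1) = (fun q => (f q)^* * (N q)^-1).
  apply/funext => q; have [fq0|fq0] := eqVneq (f q) 0.
    by rewrite /N fq0 rmorph0 !mul0r invr0.
  have fq0' : (f q)^* != 0 by rewrite conjC_eq0.
  by rewrite /N; field; rewrite fq0 fq0'.
apply: has_rderive_eq (has_rderiveM (has_rderiveJ df) dNV) _.
by rewrite /e /N; field; rewrite fp0 fp0'.
Qed.

(** Only the germ of the line at t = 0 matters, so identities valid on an open set can be
    differentiated there. *)
Lemma near_has_rderive f g v p d : (\forall t \near (0 : R),
    f (p + ofR t *: v) = g (p + ofR t *: v)) ->
  has_rderive f v p d -> has_rderive g v p d.
Proof.
move=> fg [fr fi]; split.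
  by apply: near_eq_is_derive fr => //; apply: filterS fg => t; rewrite /re_line => ->.
by apply: near_eq_is_derive fi => //; apply: filterS fg => t; rewrite /im_line => ->.
Qed.

End real_derivative.

(** * Mean value arguments: additivity in the direction, Schwarz's theorem, second derivative
    test *)

Section mixed_partials.
Variables (R : realType) (V : normedModType (Cplx R)) (O : set V).
Hypothesis oO : open O.
Implicit Types (F : V -> R) (p q u v : V).

Lemma near_plane p u v (P : set V) : nbhs p P ->
  exists2 d : R, 0 < d & forall s t : R, `|s| < d -> `|t| < d ->
    P (p + ofR s *: u + ofR t *: v).
Proof.
move=> pP.
have : (fun x : R * R => p + ofR x.1 *: u + ofR x.2 *: v) @ nbhs ((0 : R), (0 : R))
    --> p + ofR 0 *: u + ofR 0 *: v.
  apply: cvgD; [apply: cvgD; first exact: cvg_cst|].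
    apply: cvgZr_tmp; apply: (@cvg_comp _ _ _ fst (@ofR R)); first exact: cvg_fst.
    exact: continuous_ofR.
  apply: cvgZr_tmp; apply: (@cvg_comp _ _ _ snd (@ofR R)); first exact: cvg_snd.
  exact: continuous_ofR.
rewrite !line0 => /(_ _ pP) /nbhs_ballP [d /= d0 dP].
exists d => // s t sd td; apply: (dP (s, t)); split => /=.
  by rewrite /ball /= sub0r normrN.
by rewrite /ball /= sub0r normrN.
Qed.

(** Directional derivatives are always taken at parameter 0; moving the base point along the line
    gives the derivative at parameter x, which the mean value theorem needs. *)
Lemma is_derive_line F p v (x : R) (d : R) :
  @is_derive R R R 0 1 (fun t => F (p + ofR x *: v + ofR t *: v)) d ->
  @is_derive R R R x 1 (fun t => F (p + ofR t *: v)) d.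
Proof.
move=> h.
have -> : (fun t => F (p + ofR t *: v)) =
    (fun t => F (p + ofR x *: v + ofR t *: v)) \o (fun t => t - x).
  apply/funext => t /=; congr F.
  by rewrite -addrA -scalerDl -ofRD [x + _]addrC subrK.
rewrite -[d]mulr1; apply: is_derive1_comp; first by rewrite subrr.
have := is_derive_shift x (1 : R) (- x).
exact.
Qed.

(** Both signs of t are allowed; [0 < s * t] records that s lies on the same side of 0 as t, which
    the second derivative test uses. *)
Lemma mvt_line F (D : V -> R) p v (t : R) : t != 0 ->
  (forall s : R, `|s| <= `|t| -> @is_derive R R R 0 1
     (fun r => F (p + ofR s *: v + ofR r *: v)) (D (p + ofR s *: v))) ->
  exists s : R, [/\ `|s| < `|t|, 0 < s * t &
    F (p + ofR t *: v) - F p = D (p + ofR s *: v) * t].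
Proof.
move=> t0 hD.
pose h (r : R) := F (p + ofR r *: v).
have h0 : h 0 = F p by rewrite /h line0.
have dh (s : R) : `|s| <= `|t| -> @is_derive R R R s 1 h (D (p + ofR s *: v)).
  by move=> /hD; exact: is_derive_line.
have ch (a b : R) : `|a| <= `|t| -> `|b| <= `|t| -> {within `[a, b], continuous h}.
  move=> ha hb; apply: derivable_within_continuous => x; rewrite in_itv /= => xab.
  apply: ex_derive; apply: dh.
  by move: ha hb xab; rewrite !ler_norml; lra.
have [tlt0|tgt0|t_eq0] := ltgtP t 0; last by rewrite t_eq0 eqxx in t0.
  rewrite ltr0_norm // in dh ch *.
  have [||c] := @MVT R h (fun s => D (p + ofR s *: v)) t 0 tlt0.
  - by move=> x; rewrite in_itv /= => xt; apply: dh; rewrite ler_norml; lra.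
  - by apply: ch; rewrite ler_norml; lra.
  rewrite in_itv /= sub0r h0 => c0t cE; exists c; split.
  - by rewrite ltr_norml; lra.
  - by rewrite nmulr_rgt0 //; lra.
  - by rewrite -[LHS]opprB cE mulrN opprK.
rewrite gtr0_norm // in dh ch *.
have [||c] := @MVT R h (fun s => D (p + ofR s *: v)) 0 t tgt0.
- by move=> x; rewrite in_itv /= => xt; apply: dh; rewrite ler_norml; lra.
- by apply: ch; rewrite ler_norml; lra.
rewrite in_itv /= subr0 h0 => c0t cE; exists c; split => //.
- by rewrite ltr_norml; lra.
- by rewrite pmulr_rgt0 //; lra.
Qed.

(** The increment along u + v splits into one along u from p and one along v from p + t u. The
    second is t times a value of [Dv] at a point tending to p, so continuity of [Dv] at p gives its
    limit. *)
Lemma is_derive_lineD F (Du : R) (Dv : V -> R) p u v : O p ->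
  @is_derive R R R 0 1 (fun t => F (p + ofR t *: u)) Du ->
  (forall q, O q -> @is_derive R R R 0 1 (fun t => F (q + ofR t *: v)) (Dv q)) ->
  Dv @ p --> Dv p ->
  @is_derive R R R 0 1 (fun t => F (p + ofR t *: (u + v))) (Du + Dv p).
Proof.
move=> Op /is_derive1_caratheodory [g [gE cg g0]] hDv cDv.
have pO : nbhs p O by exact: open_nbhs_nbhs.
have [d1 d10 hd1] := near_plane u v pO.
(* The slope of the second increment, completed at t = 0 by its expected limit, so that [k + g] is a
   Caratheodory slope of the whole. *)
pose k (t : R) := if t == 0 then Dv p
  else (F (p + ofR t *: u + ofR t *: v) - F (p + ofR t *: u)) / t.
apply/is_derive1_caratheodory; exists (fun t => k t + g t); split.
- move=> t; rewrite mulrDl -gE !line0 subr0 scalerDr addrA.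
  rewrite /k; case: eqVneq => [->|t0]; first by rewrite !line0 !subrr; lra.
  by field.
- apply: cvgD => //.
  apply/(@cvgrPdist_lt _ R R (nbhs (0:R)) _) => e e0.
  have [d2 d20 hd2] := near_plane u v (@cvgr_dist_lt _ _ _ _ _ _ _ cDv e e0).
  have : \forall t \near (0 : R), `|0 - t| < Order.min d1 d2.
    by apply: nbhsx_ballx; rewrite lt_min d10.
  apply: filterS => t; rewrite sub0r normrN lt_min => /andP[td1 td2].
  rewrite /k eqxx; case: eqVneq => [_|t0]; first by rewrite subrr normr0.
  have [|s [st _ ->]] := @mvt_line F Dv (p + ofR t *: u) v t t0.
    by move=> s st; apply: hDv; apply: hd1 => //; apply: le_lt_trans st td1.
  rewrite mulfK //; apply: hd2 => //; exact: lt_trans st td2.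
- by rewrite /k eqxx g0 addrC.
Qed.

(** Two mean value theorems: along u for the increment of F in the direction v, then along v for
    [Du]. *)
Lemma second_difference F (Du Duv : V -> R) p u v (d t : R) : 0 < t < d ->
  (forall q, O q -> @is_derive R R R 0 1 (fun t => F (q + ofR t *: u)) (Du q)) ->
  (forall q, O q -> @is_derive R R R 0 1 (fun t => Du (q + ofR t *: v)) (Duv q)) ->
  (forall s r : R, `|s| < d -> `|r| < d -> O (p + ofR s *: u + ofR r *: v)) ->
  exists s r : R, [/\ `|s| < d, `|r| < d &
    F (p + ofR t *: u + ofR t *: v) - F (p + ofR t *: v) -
    (F (p + ofR t *: u) - F p) = Duv (p + ofR s *: u + ofR r *: v) * t * t].
Proof.
move=> /andP[t0 td] hDu hDuv hO.
have t_neq0 : t != 0 by rewrite gt_eqF.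
have nt : `|t| < d by rewrite gtr0_norm.
have d0 : `|0 : R| < d by rewrite normr0 (lt_trans t0).
pose G q := F (q + ofR t *: v) - F q.
have [|s [st _]] := @mvt_line G (fun q => Du (q + ofR t *: v) - Du q) p u t t_neq0.
  move=> s st; have sd := le_lt_trans st nt.
  apply: is_deriveB.
    have -> : (fun r => F (p + ofR s *: u + ofR r *: u + ofR t *: v)) =
        (fun r => F (p + ofR s *: u + ofR t *: v + ofR r *: u)).
      by apply/funext => r; rewrite addrAC.
    by apply: hDu; apply: hO.
  by apply: hDu; have := hO s 0 sd d0; rewrite line0.
rewrite /G [p + ofR t *: u + _]addrAC => GE.
have sd := lt_trans st nt.
have [|r [rt _ rE]] := @mvt_line Du Duv (p + ofR s *: u) v t t_neq0.
  by move=> r rt; apply: hDuv; apply: hO => //; apply: le_lt_trans rt nt.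
exists s, r; split => //; first exact: lt_trans rt nt.
by rewrite -rE -GE addrAC; lra.
Qed.

(** The second difference is symmetric in u and v, so [Duv] and [Dvu] share a value at two points
    arbitrarily close to p. If they differed by e > 0 at p, continuity would keep each within e / 2
    of its value there, a contradiction. *)
Lemma mixed_partials_eq F (Du Dv Duv Dvu : V -> R) p u v : O p ->
  (forall q, O q -> @is_derive R R R 0 1 (fun t => F (q + ofR t *: u)) (Du q)) ->
  (forall q, O q -> @is_derive R R R 0 1 (fun t => F (q + ofR t *: v)) (Dv q)) ->
  (forall q, O q -> @is_derive R R R 0 1 (fun t => Du (q + ofR t *: v)) (Duv q)) ->
  (forall q, O q -> @is_derive R R R 0 1 (fun t => Dv (q + ofR t *: u)) (Dvu q)) ->
  Duv @ p --> Duv p -> Dvu @ p --> Dvu p -> Duv p = Dvu p.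
Proof.
move=> Op hDu hDv hDuv hDvu cDuv cDvu.
have pO : nbhs p O by exact: open_nbhs_nbhs.
apply/eqP; rewrite -subr_eq0 -normr_eq0; apply/negP => /negP n0.
set e := `|_ - _| in n0; have e0 : 0 < e / 2 by rewrite divr_gt0 // lt_def n0 normr_ge0.
have [d1 d10 hd1] := near_plane u v pO.
have [d2 d20 hd2] := near_plane u v (@cvgr_dist_lt _ _ _ _ _ _ _ cDuv _ e0).
have [d3 d30 hd3] := near_plane u v (@cvgr_dist_lt _ _ _ _ _ _ _ cDvu _ e0).
pose d := Order.min d1 (Order.min d2 d3).
have d0 : 0 < d by rewrite !lt_min d10 d20.
have dd1 : d <= d1 by rewrite ge_min lexx.
have dd2 : d <= d2 by rewrite !ge_min lexx orbT.
have dd3 : d <= d3 by rewrite !ge_min lexx !orbT.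
have [t t0] : exists t : R, 0 < t < d by exists (d / 2); lra.
have hO (s r : R) : `|s| < d -> `|r| < d -> O (p + ofR s *: u + ofR r *: v).
  by move=> sd rd; apply: hd1; [apply: lt_le_trans sd _|apply: lt_le_trans rd _].
have hO' (s r : R) : `|s| < d -> `|r| < d -> O (p + ofR s *: v + ofR r *: u).
  by move=> sd rd; rewrite addrAC; apply: hO.
have [s [r [sd rd E1]]] := second_difference t0 hDu hDuv hO.
have [s' [r' [sd' rd' E2]]] := second_difference t0 hDv hDvu hO'.
have : Duv (p + ofR s *: u + ofR r *: v) = Dvu (p + ofR r' *: u + ofR s' *: v).
  have t2 : t * t != 0 by case/andP: t0 => t0 _; rewrite mulf_neq0 // gt_eqF.
  apply: (mulIf t2); rewrite !mulrA -E1 [p + ofR r' *: u + _]addrAC -E2.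
  by rewrite [p + ofR t *: v + _]addrAC; lra.
have := hd2 s r (lt_le_trans sd dd2) (lt_le_trans rd dd2).
have := hd3 r' s' (lt_le_trans rd' dd3) (lt_le_trans sd' dd3).
rewrite /= => h1 h2 h3; rewrite -h3 in h1.
have : e < e.
  move: h1 h2; move: (Duv (_ + _)) => a h1 h2; rewrite {1}/e.
  have -> : Duv p - Dvu p = (Duv p - a) - (Dvu p - a) by lra.
  by apply: le_lt_trans (ler_normB _ _) _; lra.
by rewrite ltxx.
Qed.

(** At a maximum D vanishes. If c > 0, then near p the derivative D(p + s v) is s times a positive
    slope, and the mean value theorem gives F(p + t v) > F(p) for small t > 0. *)
Lemma second_derivative_le0 F (D : V -> R) (c : R) p v : O p ->
  (forall q, O q -> @is_derive R R R 0 1 (fun t => F (q + ofR t *: v)) (D q)) ->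
  @is_derive R R R 0 1 (fun t => D (p + ofR t *: v)) c ->
  (\forall t \near (0 : R), F (p + ofR t *: v) <= F p) -> c <= 0.
Proof.
move=> Op hD dc Fmax; rewrite leNgt; apply/negP => c0.
have [e /= e0 he] : \forall t \near (0 : R),
    F (p + ofR t *: v) <= F p /\ O (p + ofR t *: v).
  by apply: filterI => //; apply: near_line.
have heP (t : R) : `|t| < e -> F (p + ofR t *: v) <= F p /\ O (p + ofR t *: v).
  by move=> te; apply: he; rewrite /ball_ /= sub0r normrN.
have Dp0 : D p = 0.
  have dF0 : @is_derive R R R 0 1 (fun t => F (p + ofR t *: v)) 0.
    apply: (@derive1_at_max R _ (- e) e).
    - lra.
    - move=> t; rewrite in_itv /= => te; apply: ex_derive.
      by apply: is_derive_line; apply: hD; apply: (heP t _).2; rewrite ltr_norml.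
    - by rewrite in_itv /=; lra.
    - move=> t; rewrite in_itv /= => te; rewrite line0.
      by apply: (heP t _).1; rewrite ltr_norml.
  by have := hD p Op; case=> _ <-; case: dF0.
move/is_derive1_caratheodory: dc => [g [gE cg g0]].
have [d /= d0 hd] : \forall t \near (0 : R), 0 < g t.
  by apply: (cvgr_gt _ cg); rewrite g0.
pose t := Order.min d e / 2.
have m0 : 0 < Order.min d e by rewrite lt_min d0 e0.
have t0 : 0 < t by rewrite /t; lra.
have tm : t < Order.min d e by rewrite /t; lra.
have [td te] : t < d /\ t < e by move: tm; rewrite lt_min => /andP.
have nt : `|t| = t by rewrite gtr0_norm.
have [||s [st s0 E]] := @mvt_line F D p v t.
- by rewrite gt_eqF.
- by move=> s; rewrite nt => st; apply: hD; apply: (heP s _).2; apply: le_lt_trans st te.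
have := (heP t _).1; rewrite nt => /(_ te); rewrite -subr_le0 E.
have := gE s; rewrite line0 Dp0 !subr0 => ->.
have gs : 0 < g s.
  by apply: hd; rewrite /ball_ /= sub0r normrN; apply: lt_trans st _; rewrite nt.
by rewrite leNgt -mulrA mulr_gt0.
Qed.

End mixed_partials.

(** * Smooth functions *)

Section smooth_functions.
Variables (R : realType) (V : normedModType (Cplx R)) (O : set V).
Hypothesis oO : open O.
Local Notation C := (Cplx R).
Implicit Types (f g : V -> C) (p q u v : V).

Lemma near_eq_line f g v p : O p -> (forall q, O q -> f q = g q) ->
  \forall t \near (0 : R), f (p + ofR t *: v) = g (p + ofR t *: v).
Proof. by move=> Op fg; apply: filterS (near_line v oO Op) => t /fg. Qed.

Lemma eq_rderivable f g v p : O p -> (forall q, O q -> f q = g q) ->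
  rderivable v f p -> rderivable v g p.
Proof.
move=> Op fg /rderiveP df.
exact: has_rderivable (near_has_rderive (near_eq_line v Op fg) df).
Qed.

Lemma eq_rderive f g v p : O p -> (forall q, O q -> f q = g q) ->
  rderivable v f p -> rderive v f p = rderive v g p.
Proof.
move=> Op fg /rderiveP df; apply/esym.
exact: has_rderive_val (near_has_rderive (near_eq_line v Op fg) df).
Qed.

Lemma eq_continuous_on f g p : O p -> (forall q, O q -> f q = g q) ->
  {for p, continuous f} -> {for p, continuous g}.
Proof.
move=> Op fg; rewrite /prop_for /continuous_at -(fg p Op) => cf.
apply: cvg_trans cf; apply: near_eq_cvg.
by apply: filterS (open_nbhs_nbhs (conj oO Op)) => q /fg.
Qed.

Lemma Cclass_continuous m f p : Cclass m O f -> O p -> {for p, continuous f}.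
Proof. by case: m => [|m] [cf _] Op; apply: cf. Qed.

(** Formulas for the derivative of a sum, product or inverse are known only on O; this carries the
    class across them. *)
Lemma eq_Cclass m f g : (forall q, O q -> f q = g q) -> Cclass m O f ->
  Cclass m O g.
Proof.
move=> fg; elim: m f g fg => [|m IH] f g fg [cf df].
  by split=> [p Op|//]; apply: eq_continuous_on Op fg (cf p Op).
split=> [p Op|v]; first exact: eq_continuous_on Op fg (cf p Op).
have [df1 df2] := df v; split=> [p Op|].
  exact: eq_rderivable Op fg (df1 p Op).
by apply: IH df2 => q Oq; apply: eq_rderive Oq fg (df1 q Oq).
Qed.

Lemma CclassW m f : Cclass m.+1 O f -> Cclass m O f.
Proof.
elim: m f => [|m IH] f; first by case.
case=> [cf df]; split => // v; have [df1 df2] := df v.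
by split => //; apply: IH.
Qed.

Lemma Cclass_cst m (c : C) : Cclass m O (fun=> c).
Proof.
elim: m c => [|m IH] c; split=> //; try by move=> p Op; apply: cst_continuous.
move=> v; split => [p _|]; first exact: has_rderivable (has_rderive_cst c v p).
apply: eq_Cclass (IH 0) => q _; apply/esym.
exact: has_rderive_val (has_rderive_cst c v q).
Qed.

Lemma CclassD m f g : Cclass m O f -> Cclass m O g ->
  Cclass m O (fun q => f q + g q).
Proof.
elim: m f g => [|m IH] f g hf hg.
  split => // p Op; apply: cvgD; first exact: (Cclass_continuous hf Op).
  exact: (Cclass_continuous hg Op).
split.
  move=> p Op; apply: cvgD; first exact: (Cclass_continuous hf Op).
  exact: (Cclass_continuous hg Op).
move=> v; have [df1 df2] := hf.2 v; have [dg1 dg2] := hg.2 v.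
have dfg q Oq := has_rderiveD (rderiveP (df1 q Oq)) (rderiveP (dg1 q Oq)).
split => [p Op|]; first exact: has_rderivable (dfg p Op).
by apply: eq_Cclass (IH _ _ df2 dg2) => q Oq; rewrite (has_rderive_val (dfg q Oq)).
Qed.

Lemma CclassM m f g : Cclass m O f -> Cclass m O g ->
  Cclass m O (fun q => f q * g q).
Proof.
elim: m f g => [|m IH] f g hf hg.
  split => // p Op; apply: cvgM; first exact: (Cclass_continuous hf Op).
  exact: (Cclass_continuous hg Op).
split.
  move=> p Op; apply: cvgM; first exact: (Cclass_continuous hf Op).
  exact: (Cclass_continuous hg Op).
move=> v; have [df1 df2] := hf.2 v; have [dg1 dg2] := hg.2 v.
have dfg q Oq := has_rderiveM (rderiveP (df1 q Oq)) (rderiveP (dg1 q Oq)).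
split => [p Op|]; first exact: has_rderivable (dfg p Op).
apply: eq_Cclass (CclassD (IH _ _ df2 (CclassW hg)) (IH _ _ (CclassW hf) dg2)).
by move=> q Oq; rewrite (has_rderive_val (dfg q Oq)).
Qed.

Lemma CclassJ m f : Cclass m O f -> Cclass m O (fun q => (f q)^*).
Proof.
elim: m f => [|m IH] f hf.
  split => // p Op; apply: (@cvg_comp _ _ _ f Num.conj).
    exact: (Cclass_continuous hf Op).
  exact: continuous_conj.
split.
  move=> p Op; apply: (@cvg_comp _ _ _ f Num.conj).
    exact: (Cclass_continuous hf Op).
  exact: continuous_conj.
move=> v; have [df1 df2] := hf.2 v.
have dfg q Oq := has_rderiveJ (rderiveP (df1 q Oq)).
split => [p Op|]; first exact: has_rderivable (dfg p Op).
by apply: eq_Cclass (IH _ df2) => q Oq; rewrite (has_rderive_val (dfg q Oq)).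
Qed.

(** The derivative - f' / f^2 contains the inverse again, but one class lower, where the induction
    hypothesis applies. *)
Lemma CclassV m f : (forall q, O q -> f q != 0) -> Cclass m O f ->
  Cclass m O (fun q => (f q)^-1).
Proof.
move=> f0; elim: m => [|m IH] hf.
  split => // p Op; apply: cvgV; first exact: f0.
  exact: (Cclass_continuous hf Op).
split.
  move=> p Op; apply: cvgV; first exact: f0.
  exact: (Cclass_continuous hf Op).
move=> v; have [df1 df2] := hf.2 v.
have dfg q Oq := has_rderiveV (f0 q Oq) (rderiveP (df1 q Oq)).
split => [p Op|]; first exact: has_rderivable (dfg p Op).
have Vf := IH (CclassW hf).
apply: eq_Cclass (CclassM (CclassM (Cclass_cst m (-1)) df2) (CclassM Vf Vf)).
by move=> q Oq; rewrite (has_rderive_val (dfg q Oq)) mulN1r expr2 invfM.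
Qed.

Lemma smooth_cst (c : C) : smooth_on O (fun=> c).
Proof. by move=> m; apply: Cclass_cst. Qed.

Lemma eq_smooth f g : (forall q, O q -> f q = g q) -> smooth_on O f ->
  smooth_on O g.
Proof. by move=> fg hf m; apply: eq_Cclass fg (hf m). Qed.

Lemma smoothD f g : smooth_on O f -> smooth_on O g ->
  smooth_on O (fun q => f q + g q).
Proof. by move=> hf hg m; apply: CclassD. Qed.

Lemma smoothM f g : smooth_on O f -> smooth_on O g ->
  smooth_on O (fun q => f q * g q).
Proof. by move=> hf hg m; apply: CclassM. Qed.

Lemma smoothJ f : smooth_on O f -> smooth_on O (fun q => (f q)^*).
Proof. by move=> hf m; apply: CclassJ. Qed.

Lemma smoothV f : (forall q, O q -> f q != 0) -> smooth_on O f ->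
  smooth_on O (fun q => (f q)^-1).
Proof. by move=> f0 hf m; apply: CclassV. Qed.

Lemma smoothN f : smooth_on O f -> smooth_on O (fun q => - f q).
Proof.
move=> hf; apply: eq_smooth (smoothM (smooth_cst (-1)) hf) => q _.
by rewrite mulN1r.
Qed.

Lemma smoothB f g : smooth_on O f -> smooth_on O g ->
  smooth_on O (fun q => f q - g q).
Proof. by move=> hf hg; apply: smoothD => //; apply: smoothN. Qed.

Lemma smooth_sum (I : Type) (r : seq I) (P : pred I) (F : I -> V -> C) :
  (forall i, P i -> smooth_on O (F i)) ->
  smooth_on O (fun q => \sum_(i <- r | P i) F i q).
Proof.
move=> hF; elim: r => [|i r IH].
  by apply: eq_smooth (smooth_cst 0) => q _; rewrite big_nil.
case Pi: (P i).
  by apply: eq_smooth (smoothD (hF i Pi) IH) => q _; rewrite big_cons Pi.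
by apply: eq_smooth IH => q _; rewrite big_cons Pi.
Qed.

Lemma smooth_prod (I : Type) (r : seq I) (P : pred I) (F : I -> V -> C) :
  (forall i, P i -> smooth_on O (F i)) ->
  smooth_on O (fun q => \prod_(i <- r | P i) F i q).
Proof.
move=> hF; elim: r => [|i r IH].
  by apply: eq_smooth (smooth_cst 1) => q _; rewrite big_nil.
case Pi: (P i).
  by apply: eq_smooth (smoothM (hF i Pi) IH) => q _; rewrite big_cons Pi.
by apply: eq_smooth IH => q _; rewrite big_cons Pi.
Qed.

Lemma smooth_continuous f p : smooth_on O f -> O p -> {for p, continuous f}.
Proof. by move=> hf; apply: Cclass_continuous (hf 0%N). Qed.

Lemma smooth_rderivable f v p : smooth_on O f -> O p -> rderivable v f p.
Proof. by move=> hf Op; have [/(_ p Op)] := (hf 1%N).2 v. Qed.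

Lemma smooth_rderive f v : smooth_on O f -> smooth_on O (rderive v f).
Proof. by move=> hf m; have [] := (hf m.+1).2 v. Qed.

Lemma smooth_has_rderive f v p : smooth_on O f -> O p ->
  has_rderive f v p (rderive v f p).
Proof. by move=> hf Op; apply: rderiveP; apply: smooth_rderivable. Qed.

Lemma cvg_Re_comp f p : {for p, continuous f} ->
  (fun q => complex.Re (f q)) @ p --> complex.Re (f p).
Proof.
move=> cf; apply: (@cvg_comp _ _ _ f (@complex.Re R) _ _ _ cf).
exact: continuous_Re.
Qed.

Lemma cvg_Im_comp f p : {for p, continuous f} ->
  (fun q => complex.Im (f q)) @ p --> complex.Im (f p).
Proof.
move=> cf; apply: (@cvg_comp _ _ _ f (@complex.Im R) _ _ _ cf).
exact: continuous_Im.
Qed.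

Lemma smooth_Re_derive f v p : smooth_on O f -> O p ->
  @is_derive R R R 0 1 (fun t => complex.Re (f (p + ofR t *: v)))
    (complex.Re (rderive v f p)).
Proof. by move=> hf Op; case: (smooth_has_rderive v hf Op) => h _; exact: h. Qed.

Lemma smooth_Im_derive f v p : smooth_on O f -> O p ->
  @is_derive R R R 0 1 (fun t => complex.Im (f (p + ofR t *: v)))
    (complex.Im (rderive v f p)).
Proof. by move=> hf Op; case: (smooth_has_rderive v hf Op) => _ h; exact: h. Qed.

(** [Cclass] treats each direction separately; additivity comes from the continuity of the
    derivative along v. *)
Lemma rderiveDv f u v p : smooth_on O f -> O p ->
  rderive (u + v) f p = rderive u f p + rderive v f p.
Proof.
move=> hf Op; apply: has_rderive_val.
have cv := smooth_continuous (smooth_rderive v hf) Op.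
split; rewrite ReIm.
  exact: (is_derive_lineD (F := fun q => complex.Re (f q))
    (Dv := fun q => complex.Re (rderive v f q)) oO Op (smooth_Re_derive u hf Op)
    (fun q => @smooth_Re_derive f v q hf) (cvg_Re_comp cv)).
exact: (is_derive_lineD (F := fun q => complex.Im (f q))
    (Dv := fun q => complex.Im (rderive v f q)) oO Op (smooth_Im_derive u hf Op)
  (fun q => @smooth_Im_derive f v q hf) (cvg_Im_comp cv)).
Qed.

Lemma rderiveZv f v p (s : R) : smooth_on O f -> O p ->
  rderive (ofR s *: v) f p = ofR s * rderive v f p.
Proof.
move=> hf Op; apply: has_rderive_val.
have lineE (F : V -> R) : (fun t => F (p + ofR t *: (ofR s *: v))) =
    (fun t => F (p + ofR t *: v)) \o (fun t => s * t).
  by apply/funext => t /=; rewrite scalerA -ofRM mulrC.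
have ds : @is_derive R R R 0 1 (fun t => s * t) s.
  by apply: is_derive_eq (is_deriveZ s (is_derive_id _ _)) _; rewrite [LHS]mulr1.
have [hr hi] := smooth_has_rderive v hf Op.
split; rewrite ReIm /= mul0r ?subr0 ?addr0 mulrC.
  rewrite /re_line (lineE (fun q => complex.Re (f q))).
  by apply: is_derive1_comp ds; rewrite mulr0.
rewrite /im_line (lineE (fun q => complex.Im (f q))).
by apply: is_derive1_comp ds; rewrite mulr0.
Qed.

Lemma rderiveC f u v p : smooth_on O f -> O p ->
  rderive u (rderive v f) p = rderive v (rderive u f) p.
Proof.
move=> hf Op.
have hu := smooth_rderive u hf; have hv := smooth_rderive v hf.
have cuv := smooth_continuous (smooth_rderive u hv) Op.
have cvu := smooth_continuous (smooth_rderive v hu) Op.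
apply: cplxP.
  exact: (mixed_partials_eq (F := fun q => complex.Re (f q))
    (Du := fun q => complex.Re (rderive v f q))
    (Dv := fun q => complex.Re (rderive u f q))
    (Duv := fun q => complex.Re (rderive u (rderive v f) q))
    (Dvu := fun q => complex.Re (rderive v (rderive u f) q)) oO Op
    (fun q => @smooth_Re_derive f v q hf) (fun q => @smooth_Re_derive f u q hf)
    (fun q => @smooth_Re_derive _ u q hv) (fun q => @smooth_Re_derive _ v q hu)
    (cvg_Re_comp cuv) (cvg_Re_comp cvu)).
exact: (mixed_partials_eq (F := fun q => complex.Im (f q))
    (Du := fun q => complex.Im (rderive v f q))
    (Dv := fun q => complex.Im (rderive u f q))
    (Duv := fun q => complex.Im (rderive u (rderive v f) q))
    (Dvu := fun q => complex.Im (rderive v (rderive u f) q)) oO Op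
    (fun q => @smooth_Im_derive f v q hf) (fun q => @smooth_Im_derive f u q hf)
  (fun q => @smooth_Im_derive _ u q hv) (fun q => @smooth_Im_derive _ v q hu)
  (cvg_Im_comp cuv) (cvg_Im_comp cvu)).
Qed.

End smooth_functions.

(** * Wirtinger calculus *)

Lemma rderive_comp_line (R : realType) (V W : normedModType (Cplx R))
    (f : W -> Cplx R) (S : V -> W) (v p : V) (w : W) :
  (forall t : R, S (p + ofR t *: v) = S p + ofR t *: w) ->
  rderive v (f \o S) p = rderive w f (S p).
Proof.
move=> E; rewrite /rderive; congr Complex; congr (derive1 _ 0).
  by apply/funext => t; rewrite /re_line /= E.
by apply/funext => t; rewrite /im_line /= E.
Qed.

(* Otherwise the tactics unfold derivatives when they compare two of them. *)
Opaque rderive.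

Section conjugation.
Variable R : realType.
Implicit Types x y : Cplx R.

Lemma conjD x y : (x + y)^* = x^* + y^*. Proof. exact: rmorphD. Qed.
Lemma conjM x y : (x * y)^* = x^* * y^*. Proof. exact: rmorphM. Qed.
Lemma conjB x y : (x - y)^* = x^* - y^*. Proof. exact: rmorphB. Qed.

Lemma conj_sum (I : Type) (r : seq I) (P : pred I) (F : I -> Cplx R) :
  (\sum_(i <- r | P i) F i)^* = \sum_(i <- r | P i) (F i)^*.
Proof. exact: rmorph_sum. Qed.

Lemma conj_half : (2^-1 : Cplx R)^* = 2^-1.
Proof. by rewrite fmorphV rmorph_nat. Qed.

End conjugation.

Section wirtinger_calculus.
Variables (R : realType) (V : normedModType (Cplx R)) (O : set V).
Hypothesis oO : open O.
Local Notation C := (Cplx R).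
Implicit Types (f g : V -> C) (p q u v : V) (D : (V -> C) -> V -> C).

(** A common form of all Wirtinger derivatives, in any direction and of either type, so that the
    product rule and commutation are proved once for all of them. *)
Definition complex_derivation D := exists (u v : V) (a b : C),
  forall f p, D f p = a * rderive u f p + b * rderive v f p.

Lemma wirtinger_cder v : complex_derivation (wirtinger v).
Proof.
exists v, ('i *: v), 2^-1, (- (2^-1 * 'i)) => f p.
by rewrite /wirtinger; ring.
Qed.

Lemma wirtinger_bar_cder v : complex_derivation (wirtinger_bar v).
Proof.
exists v, ('i *: v), 2^-1, (2^-1 * 'i) => f p.
by rewrite /wirtinger_bar; ring.
Qed.

Lemma smooth_cder D f : complex_derivation D -> smooth_on O f ->
  smooth_on O (D f).
Proof.
move=> [u [v [a [b DE]]]] hf.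
have -> : D f = fun p => a * rderive u f p + b * rderive v f p.
  by apply/funext => p.
by apply: smoothD => //; apply: smoothM => //;
  by [apply: smooth_cst|apply: smooth_rderive].
Qed.

Lemma eq_cder D f g p : complex_derivation D -> smooth_on O f ->
  (forall q, O q -> f q = g q) -> O p -> D f p = D g p.
Proof.
move=> [u [v [a [b DE]]]] hf fg Op; rewrite !DE.
by rewrite !(eq_rderive oO Op fg) //; apply: smooth_rderivable hf Op.
Qed.

Lemma cder_cst D (c : C) p : complex_derivation D -> D (fun=> c) p = 0.
Proof.
move=> [u [v [a [b DE]]]]; rewrite DE.
by rewrite !(has_rderive_val (has_rderive_cst c _ p)) !mulr0 addr0.
Qed.

Lemma cderD D f g p : complex_derivation D -> smooth_on O f -> smooth_on O g ->
  O p -> D (fun q => f q + g q) p = D f p + D g p.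
Proof.
move=> [u [v [a [b DE]]]] hf hg Op; rewrite !DE.
have h w := has_rderiveD (smooth_has_rderive w hf Op) (smooth_has_rderive w hg Op).
rewrite !(has_rderive_val (h _)).
move: (rderive u f p) (rderive u g p) (rderive v f p) (rderive v g p).
by move=> x y z t; ring.
Qed.

Lemma cderM D f g p : complex_derivation D -> smooth_on O f -> smooth_on O g ->
  O p -> D (fun q => f q * g q) p = D f p * g p + f p * D g p.
Proof.
move=> [u [v [a [b DE]]]] hf hg Op; rewrite !DE.
have h w := has_rderiveM (smooth_has_rderive w hf Op) (smooth_has_rderive w hg Op).
rewrite !(has_rderive_val (h _)).
move: (rderive u f p) (rderive u g p) (rderive v f p) (rderive v g p).
by move=> x y z t; ring.
Qed.

Lemma cderZ D (c : C) f p : complex_derivation D -> smooth_on O f ->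
  O p -> D (fun q => c * f q) p = c * D f p.
Proof.
move=> hD hf Op; rewrite cderM //; last exact: smooth_cst.
by rewrite cder_cst // mul0r add0r.
Qed.

Lemma cderN D f p : complex_derivation D -> smooth_on O f -> O p ->
  D (fun q => - f q) p = - D f p.
Proof.
move=> hD hf Op; rewrite -mulN1r -cderZ //.
by apply: (eq_cder hD) => //; [apply: smoothN|move=> q _; rewrite mulN1r].
Qed.

Lemma cderB D f g p : complex_derivation D -> smooth_on O f -> smooth_on O g ->
  O p -> D (fun q => f q - g q) p = D f p - D g p.
Proof. by move=> hD hf hg Op; rewrite cderD ?cderN //; apply: smoothN. Qed.

Lemma cder_sum D (I : Type) (r : seq I) (P : pred I) (F : I -> V -> C) p :
  complex_derivation D -> (forall i, smooth_on O (F i)) -> O p ->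
  D (fun q => \sum_(i <- r | P i) F i q) p = \sum_(i <- r | P i) D (F i) p.
Proof.
move=> hD hF Op; have hs r' := @smooth_sum _ _ _ oO _ r' P _ (fun i _ => hF i).
elim: r => [|i r IH].
  rewrite big_nil -[RHS](cder_cst 0 p hD); apply: (eq_cder hD) => // q _.
  by rewrite big_nil.
rewrite big_cons -IH; case Pi: (P i); last first.
  by apply: (eq_cder hD) => // q _; rewrite big_cons Pi.
by rewrite -cderD //; apply: (eq_cder hD) => // q _; rewrite big_cons Pi.
Qed.

Lemma cderC D D' f p : complex_derivation D -> complex_derivation D' ->
  smooth_on O f -> O p -> D (D' f) p = D' (D f) p.
Proof.
move=> [u [v [a [b DE]]]] [u' [v' [a' [b' DE']]]] hf Op.
have -> : D f = fun q => a * rderive u f q + b * rderive v f q.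
  by apply/funext.
have -> : D' f = fun q => a' * rderive u' f q + b' * rderive v' f q.
  by apply/funext.
have sm w := smooth_rderive w hf.
have hw w c d x y : rderive w (fun q => c * rderive x f q + d * rderive y f q) p =
    c * rderive w (rderive x f) p + d * rderive w (rderive y f) p.
  apply: has_rderive_val; apply: has_rderive_eq (has_rderiveD
    (has_rderiveM (has_rderive_cst c w p) (smooth_has_rderive w (sm x) Op))
    (has_rderiveM (has_rderive_cst d w p) (smooth_has_rderive w (sm y) Op))) _.
  move: (rderive x f p) (rderive y f p) => e1 e2.
  move: (rderive w (rderive x f) p) (rderive w (rderive y f) p) => e3 e4.
  by rewrite !mul0r !add0r.
rewrite DE DE' !hw.
rewrite (rderiveC oO u u' hf Op) (rderiveC oO u v' hf Op).
rewrite (rderiveC oO v u' hf Op) (rderiveC oO v v' hf Op).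
move: (rderive u' (rderive u f) p) (rderive v' (rderive u f) p).
move: (rderive u' (rderive v f) p) (rderive v' (rderive v f) p) => x y z t.
by ring.
Qed.

Lemma rderiveJ f v p : smooth_on O f -> O p ->
  rderive v (fun q => (f q)^*) p = (rderive v f p)^*.
Proof.
by move=> hf Op; apply: has_rderive_val; apply: has_rderiveJ;
  apply: smooth_has_rderive hf Op.
Qed.

Lemma wirtingerJ f v p : smooth_on O f -> O p ->
  wirtinger v (fun q => (f q)^*) p = (wirtinger_bar v f p)^*.
Proof.
move=> hf Op; rewrite /wirtinger /wirtinger_bar !(rderiveJ _ hf Op).
by rewrite conjM conjD conjM conj_half conjCi mulNr.
Qed.

Lemma wirtinger_barJ f v p : smooth_on O f -> O p ->
  wirtinger_bar v (fun q => (f q)^*) p = (wirtinger v f p)^*.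
Proof.
move=> hf Op; rewrite /wirtinger /wirtinger_bar !(rderiveJ _ hf Op).
by rewrite conjM conjB conjM conj_half conjCi mulNr opprK.
Qed.

Lemma cplx_ReIm (c : C) : c = ofR (complex.Re c) + ofR (complex.Im c) * 'i.
Proof. by apply: cplxP; rewrite !ReIm /= !(mulr0, mulr1, mul0r, subr0, addr0, add0r). Qed.

Lemma rderiveZC f (c : C) v p : smooth_on O f -> O p ->
  rderive (c *: v) f p =
  ofR (complex.Re c) * rderive v f p + ofR (complex.Im c) * rderive ('i *: v) f p.
Proof.
move=> hf Op; rewrite {1}(cplx_ReIm c) scalerDl -scalerA.
by rewrite (rderiveDv oO) // !(rderiveZv _ _ hf Op).
Qed.

Lemma wirtingerDv f u v p : smooth_on O f -> O p ->
  wirtinger (u + v) f p = wirtinger u f p + wirtinger v f p.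
Proof.
move=> hf Op; rewrite /wirtinger scalerDr !(rderiveDv oO) //.
move: (rderive u f p) (rderive _ f p) (rderive v f p) (rderive _ f p).
by move=> x y z t; ring.
Qed.

Lemma wirtinger_barDv f u v p : smooth_on O f -> O p ->
  wirtinger_bar (u + v) f p = wirtinger_bar u f p + wirtinger_bar v f p.
Proof.
move=> hf Op; rewrite /wirtinger_bar scalerDr !(rderiveDv oO) //.
move: (rderive u f p) (rderive _ f p) (rderive v f p) (rderive _ f p).
by move=> x y z t; ring.
Qed.

(** By real linearity, multiplying v by c turns the pair of directions v, ['i *: v]; on d/dx - i
    d/dy this turn acts as multiplication by c. *)
Lemma wirtingerZv f (c : C) v p : smooth_on O f -> O p ->
  wirtinger (c *: v) f p = c * wirtinger v f p.
Proof.
move=> hf Op; rewrite /wirtinger scalerA.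
rewrite (rderiveZC c v hf Op) (rderiveZC ('i * c) v hf Op).
have -> : complex.Re ('i * c) = - complex.Im c.
  by rewrite ReM Re_i Im_i mul0r mul1r sub0r.
have -> : complex.Im ('i * c) = complex.Re c.
  by rewrite ImM Re_i Im_i mul0r mul1r add0r.
rewrite [in RHS](cplx_ReIm c).
have -> : ofR (- complex.Im c) = - ofR (complex.Im c).
  by apply: cplxP; rewrite ReIm //= oppr0.
have : 'i * 'i = -1 :> C by rewrite -expr2 sqrCi.
move: (ofR (complex.Re c)) (ofR (complex.Im c)) (rderive v f p)
  (rderive ('i *: v) f p) => a b x y.
move: 'i => i i2.
have -> : (a + b * i) * (2^-1 * (x - i * y)) =
  2^-1 * (a * x + b * i * x - a * i * y - (i * i) * (b * y)) by ring.
by rewrite i2; ring.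
Qed.

(** Conjugation exchanges the two Wirtinger derivatives, which makes this one antilinear in the
    direction. *)
Lemma wirtinger_barZv f (c : C) v p : smooth_on O f -> O p ->
  wirtinger_bar (c *: v) f p = c^* * wirtinger_bar v f p.
Proof.
move=> hf Op; have hJ := smoothJ oO hf.
have E w : wirtinger_bar w f p = (wirtinger w (fun q => (f q)^*) p)^*.
  by rewrite wirtingerJ // conjCK.
by rewrite !E wirtingerZv // rmorphM.
Qed.

Lemma rderive_dir0 f p : rderive 0 f p = 0.
Proof.
apply: has_rderive_val; split.
  have -> : re_line f 0 p = cst (complex.Re (f p)).
    by apply/funext => t; rewrite /re_line scaler0 addr0.
  exact: is_derive_cst.
have -> : im_line f 0 p = cst (complex.Im (f p)).
  by apply/funext => t; rewrite /im_line scaler0 addr0.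
exact: is_derive_cst.
Qed.

Lemma wirtinger_sumv f n (w : 'I_n -> V) (c : 'I_n -> C) p :
  smooth_on O f -> O p ->
  wirtinger (\sum_k c k *: w k) f p = \sum_k c k * wirtinger (w k) f p.
Proof.
move=> hf Op; elim/big_ind2 : _ => [|x1 x2 y1 y2 <- <-|k _].
- by rewrite /wirtinger scaler0 !rderive_dir0 mulr0 subr0 mulr0.
- exact: wirtingerDv.
- exact: wirtingerZv.
Qed.

Lemma wirtinger_bar_sumv f n (w : 'I_n -> V) (c : 'I_n -> C) p :
  smooth_on O f -> O p ->
  wirtinger_bar (\sum_k c k *: w k) f p = \sum_k (c k)^* * wirtinger_bar (w k) f p.
Proof.
move=> hf Op; elim/big_ind2 : _ => [|x1 x2 y1 y2 <- <-|k _].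
- by rewrite /wirtinger_bar scaler0 !rderive_dir0 mulr0 addr0 mulr0.
- exact: wirtinger_barDv.
- exact: wirtinger_barZv.
Qed.

Lemma rderive_affine f v p (d : C) :
  (forall t : R, f (p + ofR t *: v) = f p + ofR t * d) -> has_rderive f v p d.
Proof.
move=> fE; split.
  have -> : re_line f v p = fun t => complex.Re (f p) + complex.Re d * t.
    by apply/funext => t; rewrite /re_line fE !ReIm /= mul0r subr0 mulrC.
  apply: is_derive_eq (is_deriveD (is_derive_cst _ _ _)
    (is_deriveZ (complex.Re d) (is_derive_id _ _))) _.
  by rewrite add0r [LHS]mulr1.
have -> : im_line f v p = fun t => complex.Im (f p) + complex.Im d * t.
  by apply/funext => t; rewrite /im_line fE !ReIm /= mul0r addr0 mulrC.
apply: is_derive_eq (is_deriveD (is_derive_cst _ _ _)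
  (is_deriveZ (complex.Im d) (is_derive_id _ _))) _.
by rewrite add0r [LHS]mulr1.
Qed.

End wirtinger_calculus.

(** * Functions on the slit tangent bundle *)

Lemma continuous_sum_norm (R : realType) (T : topologicalType) (n : nat)
    (F : 'I_n -> T -> Cplx R) : (forall k, continuous (F k)) ->
  continuous (fun x => \sum_k F k x * (F k x)^*).
Proof.
move=> cF; elim: (index_enum _) => [|k r IH] x.
  rewrite /continuous_at big_nil; under eq_fun do rewrite big_nil.
  exact: cst_continuous.
rewrite /continuous_at big_cons; under eq_fun do rewrite big_cons.
apply: cvgD; last exact: IH.
apply: cvgM; first exact: cF.
by apply: (@cvg_comp _ _ _ _ Num.conj _ _ _ (cF k x)); exact: continuous_conj.
Qed.

(** * Compactness of the unit sphere of C^n *)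

Section unit_sphere.
Variables (R : realType) (n : nat).
Local Notation C := (Cplx R).
Implicit Types (w : 'rV[C]_n).

Definition hermitian_sq w : C := \sum_k w 0 k * (w 0 k)^*.

Lemma hermitian_sq_ge0 w : 0 <= hermitian_sq w.
Proof. by apply: sumr_ge0 => k _; apply: mul_conjC_ge0. Qed.

Lemma hermitian_sq_eq0 w : (hermitian_sq w == 0) = (w == 0).
Proof.
apply/idP/idP => [|/eqP ->]; last first.
  by rewrite /hermitian_sq big1 // => k _; rewrite mxE mul0r.
rewrite psumr_eq0 => [/allP h|k _]; last exact: mul_conjC_ge0.
apply/eqP/rowP => k; rewrite mxE.
by have := h k (mem_index_enum k); rewrite mul_conjC_eq0 => /eqP.
Qed.

Lemma hermitian_sqZ (c : C) w :
  hermitian_sq (c *: w) = c * c^* * hermitian_sq w.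
Proof.
rewrite mulr_sumr; apply: eq_bigr => k _; rewrite mxE conjM.
by rewrite mulrACA.
Qed.

Lemma continuous_hermitian_sq : continuous hermitian_sq.
Proof.
apply: continuous_sum_norm => k w; exact: coord_continuous.
Qed.

Definition unit_sphere : set 'rV[C]_n := [set w | complex.Re (hermitian_sq w) = 1].

Lemma unit_sphereP w : unit_sphere w <-> hermitian_sq w = 1.
Proof.
rewrite /unit_sphere /=; split=> [h|->//]; apply: cplxP => //.
have := hermitian_sq_ge0 w.
by case: (hermitian_sq w) => a b; rewrite lecE /= => /andP[/eqP].
Qed.

Definition unit_square : set C :=
  (fun x : R * R => ofR x.1 + ofR x.2 * 'i) @` (`[-1, 1] `*` `[-1, 1]).

Lemma compact_unit_square : compact unit_square.
Proof.
apply: continuous_compact; last by apply: compact_setX; exact: segment_compact.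
apply: continuous_subspaceT => x; apply: cvgD.
  apply: (@cvg_comp _ _ _ fst (@ofR R)); first exact: cvg_fst.
  exact: continuous_ofR.
apply: cvgM; last exact: cvg_cst.
apply: (@cvg_comp _ _ _ snd (@ofR R)); first exact: cvg_snd.
exact: continuous_ofR.
Qed.

(** The sphere is closed, and since each coordinate of a unit vector has modulus at most 1, it lies
    in a product of compact squares. *)
Lemma compact_unit_sphere : compact unit_sphere.
Proof.
have := @rV_compact C n (fun=> unit_square) (fun=> compact_unit_square).
move=> cB; apply: subclosed_compact cB _.
  apply: (@preimage_closed _ _ (fun w => complex.Re (hermitian_sq w)) [set x | x = 1]).
    move=> w _; apply: (@cvg_comp _ _ _ hermitian_sq (@complex.Re R)).
      exact: continuous_hermitian_sq.
    exact: continuous_Re.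
  exact: closed_eq.
move=> w /unit_sphereP wS k /=; exists (complex.Re (w 0 k), complex.Im (w 0 k)).
  have : complex.Re (w 0 k) ^+ 2 + complex.Im (w 0 k) ^+ 2 <= 1.
    have : w 0 k * (w 0 k)^* <= 1.
      rewrite -wS /hermitian_sq (bigD1 k) //= lerDl.
      by apply: sumr_ge0 => j _; apply: mul_conjC_ge0.
    by case: (w 0 k) => a b; rewrite lecE /= => /andP[_]; rewrite mulrN opprK -!expr2.
  move: (complex.Re _) (complex.Im _) => a b ab.
  by split; rewrite /= in_itv /=; nra.
by rewrite -cplx_ReIm.
Qed.

Lemma unit_sphere_scale w : w != 0 ->
  exists2 c : C, c != 0 & unit_sphere (c *: w).
Proof.
move=> w0; have N0 : 0 < hermitian_sq w.
  by rewrite lt_def hermitian_sq_eq0 w0 hermitian_sq_ge0.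
have s0 : 0 < sqrtC (hermitian_sq w) by rewrite sqrtC_gt0.
exists (sqrtC (hermitian_sq w))^-1; first by rewrite invr_neq0 // gt_eqF.
apply/unit_sphereP; rewrite hermitian_sqZ.
have -> : ((sqrtC (hermitian_sq w))^-1)^* = (sqrtC (hermitian_sq w))^-1.
  by apply: CrealP; rewrite realV gtr0_real.
rewrite -invfM -expr2 sqrtCK mulVf //.
by rewrite gt_eqF.
Qed.

End unit_sphere.

(** * The slit bundle over an open set and its fibre coordinates *)

Section fibre_coordinates.
Variables (R : realType) (n : nat) (U : set 'rV[Cplx R]_n).
Hypothesis oU : open U.
Local Notation C := (Cplx R).
Local Notation TC := ('rV[C]_n * 'rV[C]_n)%type.
Implicit Types (i j k l m r h : 'I_n) (f g : TC -> C) (p q v : TC).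

Definition slit : set TC := [set q | U q.1 /\ q.2 != 0].

Lemma open_neq0 (V : normedModType C) : open [set x : V | x != 0].
Proof.
have -> : [set x : V | x != 0] = ~` [set x | x = 0].
  by apply/seteqP; split=> x /= /eqP.
apply: closed_openC; apply: accessible_closed_set1; apply: hausdorff_accessible.
exact: norm_hausdorff.
Qed.

Lemma open_slit : open slit.
Proof.
have -> : slit = (fst @^-1` U) `&` (snd @^-1` [set x | x != 0]) by [].
apply: openI; apply: open_comp => //.
- by move=> q _; apply: cvg_fst.
- by move=> q _; apply: cvg_snd.
- exact: open_neq0.
Qed.

Lemma slit_scale z eta (c : C) : c != 0 -> slit (z, eta) -> slit (z, c *: eta).
Proof. by move=> c0 [/= Uz e0]; split; rewrite //= scaler_eq0 negb_or c0. Qed.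

Definition fibre_coord k : TC -> C := fun q => q.2 0 k.

Lemma rderive_coord k v p : has_rderive (fibre_coord k) v p (v.2 0 k).
Proof. by apply: rderive_affine => t; rewrite /fibre_coord /= !mxE. Qed.

Lemma smooth_coord k : smooth_on slit (fibre_coord k).
Proof.
have cc p : {for p, continuous (fibre_coord k)}.
  apply: (@cvg_comp _ _ _ snd (fun w : 'rV[C]_n => w 0 k)); first exact: cvg_snd.
  exact: coord_continuous.
case=> [|m]; split=> // v; split.
  by move=> p _; apply: has_rderivable (rderive_coord k v p).
have E q : slit q -> v.2 0 k = rderive v (fibre_coord k) q.
  by rewrite (has_rderive_val (rderive_coord k v q)).
by apply: (@eq_Cclass _ _ _ open_slit m (fun=> v.2 0 k)) E (Cclass_cst open_slit m _).
Qed.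

Lemma wirtinger_coord k v p : wirtinger v (fibre_coord k) p = v.2 0 k.
Proof.
rewrite /wirtinger !(has_rderive_val (rderive_coord _ _ _)) /= mxE mulrA.
by rewrite -expr2 sqrCi mulN1r opprK; field.
Qed.

Lemma wirtinger_bar_coord k v p : wirtinger_bar v (fibre_coord k) p = 0.
Proof.
rewrite /wirtinger_bar !(has_rderive_val (rderive_coord _ _ _)) /= mxE mulrA.
by rewrite -expr2 sqrCi mulN1r subrr mulr0.
Qed.

Lemma row_pairE (w : 'rV[C]_n) :
  ((0, w) : TC) = \sum_k w 0 k *: ((0, delta_mx 0 k) : TC).
Proof.
rewrite {1}(row_sum_delta w); elim: (index_enum _) => [|k r IH].
  by rewrite !big_nil.
by rewrite !big_cons -IH; congr pair; rewrite /= scaler0 addr0.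
Qed.

Lemma wirtinger_fibre f (w : 'rV[C]_n) p : smooth_on slit f -> slit p ->
  wirtinger (0, w) f p = \sum_k w 0 k * d_eta k f p.
Proof.
by move=> hf Op; rewrite row_pairE (wirtinger_sumv open_slit).
Qed.

Lemma wirtinger_bar_fibre f (w : 'rV[C]_n) p : smooth_on slit f -> slit p ->
  wirtinger_bar (0, w) f p = \sum_k (w 0 k)^* * d_etabar k f p.
Proof.
by move=> hf Op; rewrite row_pairE (wirtinger_bar_sumv open_slit).
Qed.

(** A line in a fibre direction does not move z. In assertion ii the function of z is a bare
    function, so the derivative is read off the constant line. *)
Lemma d_eta_base (f : 'rV[C]_n -> C) k q : d_eta k (fun x : TC => f x.1) q = 0.
Proof.
have E (w : 'rV[C]_n) : rderive ((0, w) : TC) (fun x : TC => f x.1) q = 0.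
  apply: has_rderive_val; apply: rderive_affine => t.
  by rewrite /= scaler0 addr0 mulr0 addr0.
have iE (w : 'rV[C]_n) : 'i *: ((0, w) : TC) = (0, 'i *: w).
  by congr pair; rewrite /= scaler0.
by rewrite /d_eta /wirtinger iE !E mulr0 subr0 mulr0.
Qed.

End fibre_coordinates.

(** * Homogeneity along the fibres and Euler's relations *)

Section euler_relations.
Variables (R : realType) (n : nat) (U : set 'rV[Cplx R]_n).
Hypothesis oU : open U.
Local Notation C := (Cplx R).
Local Notation TC := ('rV[C]_n * 'rV[C]_n)%type.
Local Notation O := (slit U).
Implicit Types (f g : TC -> C) (c : C -> C) (z eta : 'rV[C]_n) (la : C).

(** The degree is a function c of the scalar rather than a number, so that it covers mixed degrees
    such as la times conj la, the degree of L. *)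
Definition homogeneous_as c f := forall z eta la, la != 0 -> O (z, eta) ->
  f (z, la *: eta) = c la * f (z, eta).

Definition fibre_scale la (q : TC) : TC := (q.1, la *: q.2).

Lemma rderive_scale f la v q :
  rderive v (f \o fibre_scale la) q = rderive (fibre_scale la v) f (fibre_scale la q).
Proof.
have E (t : R) : fibre_scale la (q + ofR t *: v) =
    fibre_scale la q + ofR t *: fibre_scale la v.
  by congr pair; rewrite /= scalerDr !scalerA mulrC.
exact: rderive_comp_line.
Qed.

Lemma wirtinger_scale f la v q :
  wirtinger v (f \o fibre_scale la) q =
  wirtinger (fibre_scale la v) f (fibre_scale la q).
Proof.
rewrite /wirtinger (rderive_scale f la v q) (rderive_scale f la ('i *: v) q).
have -> // : fibre_scale la ('i *: v) = 'i *: fibre_scale la v.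
by congr pair; rewrite /= !scalerA mulrC.
Qed.

Lemma wirtinger_bar_scale f la v q :
  wirtinger_bar v (f \o fibre_scale la) q =
  wirtinger_bar (fibre_scale la v) f (fibre_scale la q).
Proof.
rewrite /wirtinger_bar (rderive_scale f la v q) (rderive_scale f la ('i *: v) q).
have -> // : fibre_scale la ('i *: v) = 'i *: fibre_scale la v.
by congr pair; rewrite /= !scalerA mulrC.
Qed.

(** By homogeneity the composite is a constant multiple of f on O, which avoids a chain rule. *)
Lemma smooth_scale c f la : smooth_on O f -> homogeneous_as c f -> la != 0 ->
  smooth_on O (f \o fibre_scale la).
Proof.
move=> hf cf la0.
have E q : O q -> c la * f q = (f \o fibre_scale la) q.
  by case: q => z eta Oq; rewrite /= -cf.
have hcf := smoothM (open_slit oU) (smooth_cst (open_slit oU) (c la)) hf.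
by move=> m; apply: (@eq_Cclass _ _ _ (open_slit oU) m (fun q => c la * f q)) E (hcf m).
Qed.

Lemma homogeneous_cder D c f la q : complex_derivation D -> smooth_on O f ->
  homogeneous_as c f -> la != 0 -> O q ->
  D (f \o fibre_scale la) q = c la * D f q.
Proof.
move=> hD hf cf la0 Oq; rewrite -(cderZ (open_slit oU)) //.
apply: (eq_cder (open_slit oU)) => //; first exact: smooth_scale cf la0.
by move=> [z eta] Oz; rewrite /= -cf.
Qed.

(** Differentiating f(z, la eta) = c(la) f(z, eta) in eta^k brings out a factor la on the left; in
    etabar^k it would be conj la. *)
Lemma homogeneous_d_eta k c f : smooth_on O f -> homogeneous_as c f ->
  homogeneous_as (fun la => c la / la) (d_eta k f).
Proof.
move=> hf cf z eta la la0 Oq.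
have := homogeneous_cder (wirtinger_cder (0, delta_mx 0 k)) hf cf la0 Oq.
rewrite wirtinger_scale.
have -> : fibre_scale la (0, delta_mx 0 k) = la *: ((0, delta_mx 0 k) : TC).
  by congr pair; rewrite /= scaler0.
rewrite (wirtingerZv (open_slit oU)) //; last exact: slit_scale.
rewrite -/(d_eta k f _) => E; apply: (mulfI la0); rewrite E /d_eta.
by field.
Qed.

Lemma homogeneous_d_etabar k c f : smooth_on O f -> homogeneous_as c f ->
  homogeneous_as (fun la => c la / la^*) (d_etabar k f).
Proof.
move=> hf cf z eta la la0 Oq.
have la0' : la^* != 0 by rewrite conjC_eq0.
have := homogeneous_cder (wirtinger_bar_cder (0, delta_mx 0 k)) hf cf la0 Oq.
rewrite wirtinger_bar_scale.
have -> : fibre_scale la (0, delta_mx 0 k) = la *: ((0, delta_mx 0 k) : TC).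
  by congr pair; rewrite /= scaler0.
rewrite (wirtinger_barZv (open_slit oU)) //; last exact: slit_scale.
rewrite -/(d_etabar k f _) => E; apply: (mulfI la0'); rewrite E /d_etabar.
by field.
Qed.

Lemma homogeneous_d_z k c f : smooth_on O f -> homogeneous_as c f ->
  homogeneous_as c (d_z k f).
Proof.
move=> hf cf z eta la la0 Oq.
have := homogeneous_cder (wirtinger_cder (delta_mx 0 k, 0)) hf cf la0 Oq.
rewrite wirtinger_scale.
have -> : fibre_scale la (delta_mx 0 k, 0) = (delta_mx 0 k, 0).
  by congr pair; rewrite /= scaler0.
by [].
Qed.

Lemma has_rderive_along_fibre c f (e : C) d z eta : homogeneous_as c f ->
  O (z, eta) -> has_rderive (c : C^o -> C) (e : C^o) (1 : C^o) d ->
  has_rderive f (e *: ((0, eta) : TC)) (z, eta) (d * f (z, eta)).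
Proof.
move=> cf Oq hc.
have hcf : has_rderive (fun x : C^o => c x * f (z, eta)) (e : C^o) (1 : C^o)
    (d * f (z, eta)).
  apply: has_rderive_eq (has_rderiveM hc (has_rderive_cst (f (z, eta)) _ _)) _.
  by rewrite mulr0 addr0.
have E : \forall t \near (0 : R), c (1 + ofR t * e) * f (z, eta) =
    f ((z, eta) + ofR t *: (e *: ((0, eta) : TC))).
  (* Moving eta in the direction e eta multiplies it by 1 + t e, and homogeneity speaks only of
     nonzero scalars. *)
  have : \forall t \near (0 : R), (1 : C^o) + ofR t *: (e : C^o) != 0.
    apply: (@near_line _ C^o [set x | x != 0]); last exact: oner_neq0.
    exact: open_neq0.
  apply: filterS => t t0; rewrite -cf //; congr f; congr pair.
    by rewrite /= !scaler0 addr0.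
  by rewrite /= scalerDl scale1r !scalerA.
case: hcf => hr hi; split.
  apply: near_eq_is_derive hr => //; apply: filterS E => t.
  by rewrite /re_line => ->.
apply: near_eq_is_derive hi => //; apply: filterS E => t.
by rewrite /im_line => ->.
Qed.

(** The factor (a - i b) / 2 is the Wirtinger derivative of c at 1: it is 1 for la, 0 for conj la
    and 2 for la^2. *)
Lemma euler_d_eta c f (a b : C) z eta : smooth_on O f -> homogeneous_as c f ->
  O (z, eta) ->
  has_rderive (c : C^o -> C) (1 : C^o) (1 : C^o) a ->
  has_rderive (c : C^o -> C) ('i : C^o) (1 : C^o) b ->
  \sum_k d_eta k f (z, eta) * eta 0 k = 2^-1 * (a - 'i * b) * f (z, eta).
Proof.
move=> hf cf Oq ha hb.
have -> : \sum_k d_eta k f (z, eta) * eta 0 k = wirtinger (0, eta) f (z, eta).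
  by rewrite (wirtinger_fibre oU) //; apply: eq_bigr => k _; rewrite mulrC.
rewrite /wirtinger -[(0, eta)]scale1r.
rewrite (has_rderive_val (has_rderive_along_fibre cf Oq ha)).
rewrite scale1r (has_rderive_val (has_rderive_along_fibre cf Oq hb)).
move: (f _) 'i (2^-1) => x y t; by ring.
Qed.

Lemma euler_d_etabar c f (a b : C) z eta : smooth_on O f -> homogeneous_as c f ->
  O (z, eta) ->
  has_rderive (c : C^o -> C) (1 : C^o) (1 : C^o) a ->
  has_rderive (c : C^o -> C) ('i : C^o) (1 : C^o) b ->
  \sum_k d_etabar k f (z, eta) * (eta 0 k)^* = 2^-1 * (a + 'i * b) * f (z, eta).
Proof.
move=> hf cf Oq ha hb.
have -> : \sum_k d_etabar k f (z, eta) * (eta 0 k)^* =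
    wirtinger_bar (0, eta) f (z, eta).
  by rewrite (wirtinger_bar_fibre oU) //; apply: eq_bigr => k _; rewrite mulrC.
rewrite /wirtinger_bar -[(0, eta)]scale1r.
rewrite (has_rderive_val (has_rderive_along_fibre cf Oq ha)).
rewrite scale1r (has_rderive_val (has_rderive_along_fibre cf Oq hb)).
move: (f _) 'i (2^-1) => x y t; by ring.
Qed.

End euler_relations.

(** * Holomorphic homogeneous functions *)

Lemma continuous_pairl (S T : topologicalType) (x : S) :
  continuous (fun y : T => (x, y)).
Proof. by move=> y; apply: cvg_pair; [exact: cvg_cst|exact: cvg_id]. Qed.

Lemma cplx_ge0_Re_le0 (R : realType) (x : Cplx R) : 0 <= x ->
  complex.Re x <= 0 -> x = 0.
Proof.
case: x => a b; rewrite lecE /= => /andP[/eqP -> a0] a1.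
by congr Complex; apply/eqP; rewrite eq_le a0 a1.
Qed.

Lemma cplx_segment_1_i (R : realType) (r : R) : 1 + ofR r * ('i - 1) != 0 :> Cplx R.
Proof.
apply/eqP => E; have := congr1 (@complex.Re R) E; have := congr1 (@complex.Im R) E.
by rewrite !ReIm /=; lra.
Qed.

Lemma cplx_segment_i_real (R : realType) (s r : R) : s != 0 ->
  'i + ofR r * (ofR s - 'i) != 0 :> Cplx R.
Proof.
move=> s0; apply/eqP => E.
have := congr1 (@complex.Re R) E; have := congr1 (@complex.Im R) E.
rewrite !ReIm /= => h1 h2; have r1 : r = 1 by lra.
by case/eqP: s0; move: h2; rewrite r1; lra.
Qed.

(** * The Laplacian on a complex line at a maximum *)

Section maximum.
Variables (R : realType) (V : normedModType (Cplx R)) (O : set V).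
Hypothesis oO : open O.
Local Notation C := (Cplx R).

Lemma rderive_lincomb (a b : C) (f g : V -> C) (v p : V) : smooth_on O f ->
  smooth_on O g -> O p ->
  rderive v (fun q => a * (f q + b * g q)) p = a * (rderive v f p + b * rderive v g p).
Proof.
move=> hf hg Op; apply: has_rderive_val; apply: has_rderive_eq (has_rderiveM
  (has_rderive_cst a v p) (has_rderiveD (smooth_has_rderive v hf Op) (has_rderiveM
  (has_rderive_cst b v p) (smooth_has_rderive v hg Op)))) _.
move: (rderive v f p) (rderive v g p) => x y.
by rewrite !mul0r !add0r.
Qed.

(** A quarter of the Laplacian on the complex line through p along v; the mixed terms cancel by
    Schwarz's theorem. *)
Lemma wirtinger_wirtinger_bar (f : V -> C) (v p : V) : smooth_on O f -> O p ->
  wirtinger v (wirtinger_bar v f) p =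
  ofR (4^-1) * (rderive v (rderive v f) p + rderive ('i *: v) (rderive ('i *: v) f) p).
Proof.
move=> hf Op; rewrite /wirtinger /wirtinger_bar.
rewrite !(rderive_lincomb _ _ _ (smooth_rderive _ hf) (smooth_rderive _ hf) Op).
rewrite (rderiveC oO v ('i *: v) hf Op).
have -> : ofR 4^-1 = 2^-1 * 2^-1 :> C.
  have -> : (2^-1 : C) = ofR 2^-1.
    apply: (mulfI (_ : 2 != 0 :> C)); first by rewrite pnatr_eq0.
    rewrite divff ?pnatr_eq0 //; have -> : (2 : C) = ofR 2.
      by apply: cplxP; rewrite ReIm //= addr0.
    by rewrite -ofRM divff ?pnatr_eq0 // ofR1.
  by rewrite -ofRM -invfM -natrM.
have : 'i * 'i = -1 :> C by rewrite -expr2 sqrCi.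
move: (rderive v (rderive v f) p) (rderive ('i *: v) (rderive v f) p)
  (rderive ('i *: v) (rderive ('i *: v) f) p) => x z y.
move: 'i (2^-1) => i h ii.
have -> : h * (h * (x + i * z) - i * (h * (z + i * y))) =
  h * h * (x - i * i * y) by ring.
by rewrite ii mulN1r opprK.
Qed.

Lemma second_derivative_max (f : V -> C) (v p : V) : smooth_on O f -> O p ->
  (\forall t \near (0 : R), complex.Re (f (p + ofR t *: v)) <= complex.Re (f p)) ->
  complex.Re (rderive v (rderive v f) p) <= 0.
Proof.
move=> hf Op fmax.
apply: (second_derivative_le0 oO Op (F := fun q => complex.Re (f q))
  (D := fun q => complex.Re (rderive v f q)) _ _ fmax).
  by move=> q Oq; exact: smooth_Re_derive hf Oq.
exact: smooth_Re_derive (smooth_rderive v hf) Op.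
Qed.

Lemma wirtinger_max (f : V -> C) (v p : V) : smooth_on O f -> O p ->
  (forall e : C, \forall t \near (0 : R),
     complex.Re (f (p + ofR t *: (e *: v))) <= complex.Re (f p)) ->
  complex.Re (wirtinger v (wirtinger_bar v f) p) <= 0.
Proof.
move=> hf Op fmax; rewrite wirtinger_wirtinger_bar //.
have h1 := second_derivative_max hf Op (fmax 1); rewrite scale1r in h1.
have h2 := second_derivative_max hf Op (fmax 'i).
rewrite ReM /= mul0r subr0 ReD.
have H (x y : R) : x <= 0 -> y <= 0 -> 4^-1 * (x + y) <= 0 by clear; lra.
exact: (H _ _ h1 h2).
Qed.

End maximum.

(** * Constancy of holomorphic functions of degree 0 on the slit fibres *)

Section holomorphic_homogeneous.
Variables (R : realType) (n : nat) (U : set 'rV[Cplx R]_n).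
Hypothesis oU : open U.
Local Notation C := (Cplx R).
Local Notation TC := ('rV[C]_n * 'rV[C]_n)%type.
Local Notation O := (slit U).
Implicit Types (f g : TC -> C) (z eta : 'rV[C]_n).

(** Every nonzero vector can be scaled to the unit sphere without changing a function of degree 0,
    so the maximum on the compact sphere is global on the fibre. *)
Lemma slit_max (G : TC -> C) z : smooth_on O G -> U z ->
  homogeneous_as U (fun=> 1) G -> (exists eta : 'rV[C]_n, eta != 0) ->
  exists2 p, unit_sphere p & forall eta, eta != 0 ->
    complex.Re (G (z, eta)) <= complex.Re (G (z, p)).
Proof.
move=> hG Uz G0 [eta0 eta00].
have sphere0 (w : 'rV[C]_n) : unit_sphere w -> w != 0.
  move=> /unit_sphereP wS; apply/eqP => w0; move/eqP: wS.
  by rewrite w0 (eqP (_ : hermitian_sq 0 == 0)) ?hermitian_sq_eq0 // eq_sym oner_eq0.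
have [|||p] := @compact_EVT_max _ R (fun w => complex.Re (G (z, w))) (@unit_sphere R n).
- by have [c _ cS] := unit_sphere_scale eta00; exists (c *: eta0).
- exact: compact_unit_sphere.
- apply: continuous_in_subspaceT => w /set_mem wS.
  have Ow : O (z, w) by split => //; exact: sphere0.
  apply: (@cvg_comp _ _ _ (fun w => G (z, w)) (@complex.Re R)); last exact: continuous_Re.
  apply: (@cvg_comp _ _ _ (fun w => (z, w)) G); last exact: (smooth_continuous hG Ow).
  exact: continuous_pairl.
move=> /set_mem pS pmax; exists p => // eta eta_neq0.
have [c c0 cS] := unit_sphere_scale eta_neq0.
by have := pmax _ (mem_set cS); rewrite G0 // mul1r.
Qed.

Lemma orthogonal_direction (p : 'rV[C]_n) (i j : 'I_n) : i != j -> p != 0 ->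
  exists2 v : 'rV[C]_n, v != 0 & \sum_k v 0 k * (p 0 k)^* = 0.
Proof.
move=> ij p0.
(* Either the i-th basis vector is already orthogonal to p, or (- conj p_j, conj p_i) in the
   coordinates i, j is a nonzero orthogonal vector. *)
have [pi0|pi_neq0] := eqVneq (p 0 i) 0.
  exists (delta_mx 0 i).
    by apply/eqP => /rowP /(_ i); rewrite !mxE !eqxx; apply/eqP; rewrite oner_eq0.
  rewrite (bigD1 i) //= pi0 conjC0 mulr0 add0r big1 // => k ki.
  by rewrite mxE (negbTE ki) andbF mul0r.
exists (\row_k (if k == i then - (p 0 j)^* else if k == j then (p 0 i)^* else 0)).
  apply/eqP => /rowP /(_ j); rewrite !mxE eq_sym (negbTE ij) eqxx.
  by apply/eqP; rewrite conjC_eq0.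
rewrite (bigD1 i) //= (bigD1 j) /=; last by rewrite eq_sym.
rewrite big1 => [|k /andP[ki kj]]; last by rewrite mxE (negbTE ki) (negbTE kj) mul0r.
rewrite !mxE eqxx [j == i]eq_sym (negbTE ij) eqxx addr0.
by rewrite mulNr mulrC addNr.
Qed.

Definition fibre_sq (q : TC) : C :=
  \sum_k fibre_coord k q * (fibre_coord k q)^*.

Lemma smooth_fibre_sq : smooth_on O fibre_sq.
Proof.
apply: smooth_sum; first exact: open_slit.
by move=> k _; apply: smoothM; [exact: open_slit|exact: smooth_coord|
  apply: smoothJ; [exact: open_slit|exact: smooth_coord]].
Qed.

(* At a maximum (z, p) of G = |phi|^2 |eta|^2 with |p| = 1 and v orthogonal to p,
   the second derivative of G along v and its conjugate is
   |d phi / dv|^2 + |phi|^2 |v|^2. *)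
Lemma holomorphic_degree_m1 (phi : TC -> C) (i j : 'I_n) : i != j ->
  smooth_on O phi -> homogeneous_as U (fun la => la^-1) phi ->
  (forall k q, O q -> d_etabar k phi q = 0) -> forall q, O q -> phi q = 0.
Proof.
move=> ij hphi c_phi phi_hol [z eta] [/= Uz eta0].
have oO := open_slit oU.
pose G q := phi q * (phi q)^* * fibre_sq q.
have hJ := smoothJ oO hphi.
have hG : smooth_on O G.
  apply: smoothM => //; first exact: smoothM.
  exact: smooth_fibre_sq.
have G0 : homogeneous_as U (fun=> 1) G.
  move=> z1 eta1 la la0 Oq; rewrite /G c_phi // conjM.
  have -> : (la^-1)^* = (la^*)^-1 by exact: fmorphV.
  have -> : fibre_sq (z1, la *: eta1) = la * la^* * fibre_sq (z1, eta1).
    exact: hermitian_sqZ.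
  have la0' : la^* != 0 by rewrite conjC_eq0.
  move: (phi _) (fibre_sq _) la0 la0' => x y; move: la^* x^* => la' x' la0 la0'.
  by field; rewrite la0 la0'.
have [|p pS pmax] := slit_max hG Uz G0; first by exists eta.
have N1 : fibre_sq (z, p) = 1 by apply/unit_sphereP.
have p0 : p != 0.
  by rewrite -hermitian_sq_eq0 -[hermitian_sq p]/(fibre_sq (z, p)) N1 oner_eq0.
have [v v0 vp] := orthogonal_direction ij p0.
have Op : O (z, p) by [].
have maxG (e : C) : \forall t \near (0 : R),
    complex.Re (G ((z, p) + ofR t *: (e *: ((0, v) : TC)))) <=
    complex.Re (G (z, p)).
  apply: filterS (near_line (e *: ((0, v) : TC)) oO Op) => t [_ /= t0].
  have -> : ((z, p) : TC) + ofR t *: (e *: ((0, v) : TC)) =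
      (z, p + ofR t *: (e *: v)).
    by congr pair; rewrite /= !scaler0 addr0.
  exact: pmax.
have := wirtinger_max oO hG Op maxG.
have -> : wirtinger (0, v) (wirtinger_bar (0, v) G) (z, p) =
    wirtinger (0, v) phi (z, p) * (wirtinger (0, v) phi (z, p))^* +
    phi (z, p) * (phi (z, p))^* * hermitian_sq v.
  set D := wirtinger (0, v); set D' := wirtinger_bar (0, v).
  have cD : complex_derivation D by exact: wirtinger_cder.
  have cD' : complex_derivation D' by exact: wirtinger_bar_cder.
  have hN := @smooth_fibre_sq.
  have sD f : smooth_on O f -> smooth_on O (D f) by exact: smooth_cder.
  have sD' f : smooth_on O f -> smooth_on O (D' f) by exact: smooth_cder.
  have D'phi q : O q -> D' phi q = 0.
    move=> Oq; rewrite /D' (wirtinger_bar_fibre oU) // big1 // => k _.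
    by rewrite phi_hol // mulr0.
  have DJ f q : smooth_on O f -> O q -> D (fun x => (f x)^*) q = (D' f q)^*.
    by move=> hf Oq; exact: wirtingerJ hf Oq.
  have D'J f q : smooth_on O f -> O q -> D' (fun x => (f x)^*) q = (D f q)^*.
    by move=> hf Oq; exact: wirtinger_barJ hf Oq.
  have hc k := @smooth_coord R n U oU k.
  have hcJ k := smoothJ oO (hc k).
  have DN q : O q -> D fibre_sq q = \sum_k v 0 k * (fibre_coord k q)^*.
    move=> Oq; rewrite /fibre_sq (cder_sum oO) //; last by move=> k; apply: smoothM.
    apply: eq_bigr => k _; rewrite (cderM (O := O)) // DJ //.
    by rewrite /D /D' wirtinger_coord wirtinger_bar_coord conjC0 mulr0 addr0.
  have D'N q : O q -> D' fibre_sq q = \sum_k fibre_coord k q * (v 0 k)^*.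
    move=> Oq; rewrite /fibre_sq (cder_sum oO) //; last by move=> k; apply: smoothM.
    apply: eq_bigr => k _; rewrite (cderM (O := O)) // D'J //.
    by rewrite /D /D' wirtinger_coord wirtinger_bar_coord mul0r add0r.
  have hDphiJ : smooth_on O (fun q => (D phi q)^*) by apply: smoothJ; auto.
  have D'G q : O q -> D' G q =
      phi q * (D phi q)^* * fibre_sq q + phi q * (phi q)^* * D' fibre_sq q.
    move=> Oq; rewrite /G (cderM (O := O)) //; last exact: smoothM.
    rewrite (cderM (O := O)) // D'J // D'phi // mul0r add0r.
    by [].
  rewrite (eq_cder oO cD _ D'G Op); last exact: sD'.
  have s1 : smooth_on O (fun q => phi q * (D phi q)^*) by exact: smoothM.
  have s2 : smooth_on O (fun q => phi q * (phi q)^*) by exact: smoothM.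
  have s3 : smooth_on O (D' fibre_sq) by exact: sD'.
  rewrite (cderD (O := O)) //; [|exact: smoothM|exact: smoothM].
  rewrite (cderM cD s1) // (cderM cD s2) // (cderM cD hphi hDphiJ) //.
  rewrite (cderM cD hphi hJ) // !DJ //; last exact: sD.
  rewrite D'phi // DN // D'N //.
  have -> : D' (D phi) (z, p) = 0.
    rewrite (cderC oO) // (eq_cder oO cD (sD' _ hphi) D'phi Op).
    by rewrite cder_cst.
  (* Orthogonality of v and p annihilates both first derivatives of |eta|^2 at p, and with them the
     cross terms of the product rule. *)
  rewrite N1 [\sum_k v 0 k * _]vp.
  have -> : \sum_k fibre_coord k (z, p) * (v 0 k)^* = 0.
    transitivity ((\sum_k v 0 k * (p 0 k)^*)^*); last by rewrite vp conjC0.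
    rewrite conj_sum; apply: eq_bigr => k _.
    by rewrite conjM conjCK mulrC.
  have -> : D (D' fibre_sq) (z, p) = hermitian_sq v.
    rewrite (eq_cder oO cD s3 D'N Op) (cder_sum oO) //; last first.
      by move=> k; apply: smoothM => //; exact: smooth_cst.
    apply: eq_bigr => k _; rewrite (cderM (O := O)) //; last exact: smooth_cst.
    by rewrite cder_cst // mulr0 addr0 /D wirtinger_coord.
  by rewrite conjC0 !mulr0 !mulr1 !addr0 !add0r.
move=> le0.
(* Both summands are nonnegative while their sum has nonpositive real part, so each vanishes; the
   second contains |v|^2, which is not 0. *)
have phip0 : phi (z, p) = 0.
  have T1 := mul_conjC_ge0 (wirtinger (0, v) phi (z, p)).
  have T2 : 0 <= phi (z, p) * (phi (z, p))^* * hermitian_sq v.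
    by rewrite mulr_ge0 ?mul_conjC_ge0 ?hermitian_sq_ge0.
  have /eqP := cplx_ge0_Re_le0 (addr_ge0 T1 T2) le0.
  rewrite paddr_eq0 // => /andP[_].
  by rewrite mulf_eq0 hermitian_sq_eq0 (negbTE v0) orbF mul_conjC_eq0 => /eqP.
(* The maximum of the nonnegative G is thus 0, so G, and with it phi, vanishes on the whole
   fibre. *)
have := pmax eta eta0; rewrite /G phip0 !mul0r => le_eta.
have G_ge0 : 0 <= phi (z, eta) * (phi (z, eta))^* * fibre_sq (z, eta).
  by rewrite mulr_ge0 ?mul_conjC_ge0 //; exact: hermitian_sq_ge0.
have /eqP := cplx_ge0_Re_le0 G_ge0 le_eta.
rewrite mulf_eq0 -[fibre_sq _]/(hermitian_sq eta) hermitian_sq_eq0 (negbTE eta0) orbF.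
by rewrite mul_conjC_eq0 => /eqP.
Qed.

Lemma holomorphic_degree0 (f : TC -> C) : smooth_on O f ->
  homogeneous_as U (fun=> 1) f -> (forall k q, O q -> d_etabar k f q = 0) ->
  forall k q, O q -> d_eta k f q = 0.
Proof.
move=> hf f0 f_hol k [z eta] Oq; have oO := open_slit oU.
have [j jk|one] := pickP [pred j : 'I_n | j != k].
  apply: (holomorphic_degree_m1 (i := j) (j := k)) => //.
  - by apply: smooth_cder => //; exact: wirtinger_cder.
  - move=> z1 eta1 la la0 O1; rewrite (homogeneous_d_eta oU k hf f0) //.
    by rewrite mul1r.
  move=> l q1 Oq1; rewrite /d_etabar /d_eta.
  rewrite (cderC oO (wirtinger_bar_cder _) (wirtinger_cder _)) //.
  rewrite (eq_cder oO (g := fun=> 0) (wirtinger_cder _) _ _ Oq1).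
  - by rewrite cder_cst //; exact: wirtinger_cder.
  - by apply: smooth_cder => //; exact: wirtinger_bar_cder.
  - by move=> q2; exact: f_hol.
(* Now k is the only index, so n = 1: Euler's relation in degree 0 reads (df / d eta) eta = 0, and
   eta is not 0. *)
have [_ /= eta0] := Oq.
have c1 (e : C) : has_rderive ((fun=> 1) : C^o -> C) (e : C^o) (1 : C^o) 0.
  exact: has_rderive_cst.
have := euler_d_eta oU hf f0 Oq (c1 1) (c1 'i).
rewrite mulr0 subr0 mulr0 mul0r (bigD1 k) //= big1 => [|i ik]; last first.
  by have := one i; rewrite /= ik.
rewrite addr0 => /eqP; rewrite mulf_eq0 => /orP[/eqP //|/eqP etak].
case/eqP: eta0; apply/rowP => i; rewrite mxE.
by have := one i => /= /negbFE /eqP ->.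
Qed.

Lemma antiholomorphic_degree0 (f : TC -> C) : smooth_on O f ->
  homogeneous_as U (fun=> 1) f -> (forall k q, O q -> d_eta k f q = 0) ->
  forall k q, O q -> d_etabar k f q = 0.
Proof.
move=> hf f0 f_ahol k q Oq; have oO := open_slit oU; have hJ := smoothJ oO hf.
apply: (can_inj (@conjCK _)); rewrite conjC0 /d_etabar -(wirtingerJ _ hf Oq).
apply: (holomorphic_degree0 hJ) => //.
  by move=> z eta la la0 O1; rewrite f0 // !mul1r.
move=> l p Op; rewrite /d_etabar (wirtinger_barJ _ hf Op).
by rewrite -[wirtinger _ _ _]/(d_eta l f p) f_ahol // conjC0.
Qed.

(** The two Wirtinger derivatives span all real fibre derivatives, so f is constant on segments
    avoiding the origin. The slit fibre is not convex, hence such segments have to be chained. *)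
Lemma fibrewise_constant (f : TC -> C) : smooth_on O f ->
  (forall k q, O q -> d_eta k f q = 0) ->
  (forall k q, O q -> d_etabar k f q = 0) ->
  forall z eta eta', O (z, eta) -> O (z, eta') -> f (z, eta) = f (z, eta').
Proof.
move=> hf f_eta f_etabar.
have D0 (w : 'rV[C]_n) q : O q -> rderive ((0, w) : TC) f q = 0.
  move=> Oq; have -> : rderive ((0, w) : TC) f q =
      wirtinger (0, w) f q + wirtinger_bar (0, w) f q.
    rewrite /wirtinger /wirtinger_bar.
    move: (rderive _ f q) ('i * _) => x y.
    by field.
  rewrite (wirtinger_fibre oU) // (wirtinger_bar_fibre oU) //.
  rewrite !big1 ?addr0 // => k _; first by rewrite f_etabar ?mulr0.
  by rewrite f_eta ?mulr0.
have seg z (x y : 'rV[C]_n) : U z -> (forall t : R, x + ofR t *: (y - x) != 0) ->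
    f (z, x) = f (z, y).
  move=> Uz xy0.
  have lineE (t : R) : ((z, x) : TC) + ofR t *: ((0, y - x) : TC) =
      (z, x + ofR t *: (y - x)).
    by congr pair; rewrite /= scaler0 addr0.
  have y1 : x + ofR 1 *: (y - x) = y by rewrite scale1r addrC subrK.
  apply: cplxP.
    have [||s [_ _]] := @mvt_line _ _ (fun q => complex.Re (f q)) (fun=> 0)
      (z, x) (0, y - x) 1.
    - exact: oner_neq0.
    - move=> s _; have Os : O ((z, x) + ofR s *: ((0, y - x) : TC)).
        by rewrite lineE; split; [exact: Uz|exact: xy0].
      by have := smooth_Re_derive (0, y - x) hf Os; rewrite D0.
    by rewrite lineE y1 mul0r => /eqP; rewrite subr_eq0 => /eqP.
  have [||s [_ _]] := @mvt_line _ _ (fun q => complex.Im (f q)) (fun=> 0)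
    (z, x) (0, y - x) 1.
  - exact: oner_neq0.
  - move=> s _; have Os : O ((z, x) + ofR s *: ((0, y - x) : TC)).
      by rewrite lineE; split; [exact: Uz|exact: xy0].
    by have := smooth_Im_derive (0, y - x) hf Os; rewrite D0.
  by rewrite lineE y1 mul0r => /eqP; rewrite subr_eq0 => /eqP.
move=> z x y [/= Uz x0] [_ /= y0].
(* The segment from x to y meets 0 only if y is a real multiple of x; then the
   path through 'i *: x avoids 0. *)
have [xy0|] := pselect (forall t : R, x + ofR t *: (y - x) != 0); first exact: seg.
move=> /existsNP [t /negP/negPn/eqP xy0].
have segC (a b : C) : (forall r : R, a + ofR r * (b - a) != 0) ->
    f (z, a *: x) = f (z, b *: x).
  move=> ab0; apply: seg => // r.
  by rewrite -scalerBl scalerA -scalerDl scaler_eq0 negb_or ab0.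
have t0 : t != 0.
  by apply: contra_neq x0 => t0; move: xy0; rewrite t0 line0.
have t0' : ofR t != 0 by apply: contra t0 => /eqP [->].
(* Solving x + t (y - x) = 0 for y gives y = ((t - 1) / t) x. *)
pose s := (t - 1) / t.
have yE : y = ofR s *: x.
  apply: (scalerI t0'); rewrite scalerA -ofRM /s mulrCA divff // mulr1.
  have -> : ofR (t - 1) = ofR t - 1.
    by apply: cplxP; rewrite !ReIm //= oppr0 addr0.
  rewrite scalerBl scale1r; apply/eqP; rewrite -subr_eq0 -xy0 scalerBr.
  by apply/eqP; rewrite opprB addrCA.
have s0 : s != 0.
  by apply: contra_neq y0 => s0; rewrite yE s0 scale0r.
rewrite -[x]scale1r yE (segC 1 'i) ?(segC 'i (ofR s)) //.
- by move=> r; exact: cplx_segment_i_real.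
- by move=> r; exact: cplx_segment_1_i.
Qed.

End holomorphic_homogeneous.
Opaque wirtinger wirtinger_bar.

(** * Finsler geometry in a chart *)

Lemma eq_invmx (K : comUnitRingType) m (F G : 'I_m -> 'I_m -> K) i j :
  F =2 G -> invmx (\matrix_(k, l) F k l) i j = invmx (\matrix_(k, l) G k l) i j.
Proof. by move=> FG; congr (invmx _ i j); apply/matrixP => k l; rewrite !mxE. Qed.

(** * Smoothness of the inverse of a matrix of smooth functions *)

Section determinants.
Variables (R : realType) (V : normedModType (Cplx R)) (O : set V).
Hypothesis oO : open O.

Lemma smooth_det m (A : V -> 'M[Cplx R]_m) :
  (forall i j, smooth_on O (fun q => A q i j)) -> smooth_on O (fun q => \det (A q)).
Proof.
move=> hA; apply: (smooth_sum oO) => s _; apply: (smoothM oO).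
  exact: smooth_cst.
by apply: (smooth_prod oO) => i _.
Qed.

Lemma smooth_cofactor m (A : V -> 'M[Cplx R]_m) i j :
  (forall i j, smooth_on O (fun q => A q i j)) ->
  smooth_on O (fun q => cofactor (A q) i j).
Proof.
move=> hA; apply: (smoothM oO); first exact: smooth_cst.
apply: smooth_det => k l.
by apply: eq_smooth (hA (lift i k) (lift j l)) => // q _; rewrite !mxE.
Qed.

Lemma smooth_invmx m (A : V -> 'M[Cplx R]_m) i j :
  (forall q, O q -> A q \in unitmx) ->
  (forall i j, smooth_on O (fun q => A q i j)) ->
  smooth_on O (fun q => invmx (A q) i j).
Proof.
move=> uA hA; apply: (eq_smooth oO) (smoothM oO (smoothV oO _ (smooth_det hA))
  (smooth_cofactor j i hA)) => q Oq.
  by rewrite /invmx uA // !mxE.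
by have := uA q Oq; rewrite unitmxE unitfE.
Qed.

End determinants.

Section local_finsler.
Variables (R : realType) (n : nat) (U : set 'rV[Cplx R]_n).
Hypothesis oU : open U.
Local Notation C := (Cplx R).
Local Notation TC := ('rV[C]_n * 'rV[C]_n)%type.
Local Notation O := (slit U).
Local Notation y k := (@fibre_coord R n k).
Implicit Types (i j k l m r h s : 'I_n) (f : TC -> C) (q : TC).

Let oO : open O := open_slit oU.

Lemma d_z_cder k : complex_derivation (@d_z R n k).
Proof. exact: wirtinger_cder. Qed.
Lemma d_zbar_cder k : complex_derivation (@d_zbar R n k).
Proof. exact: wirtinger_bar_cder. Qed.
Lemma d_eta_cder k : complex_derivation (@d_eta R n k).
Proof. exact: wirtinger_cder. Qed.
Lemma d_etabar_cder k : complex_derivation (@d_etabar R n k).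
Proof. exact: wirtinger_bar_cder. Qed.

Lemma smooth_d_z k f : smooth_on O f -> smooth_on O (d_z k f).
Proof. exact: smooth_cder (d_z_cder k). Qed.
Lemma smooth_d_zbar k f : smooth_on O f -> smooth_on O (d_zbar k f).
Proof. exact: smooth_cder (d_zbar_cder k). Qed.
Lemma smooth_d_eta k f : smooth_on O f -> smooth_on O (d_eta k f).
Proof. exact: smooth_cder (d_eta_cder k). Qed.
Lemma smooth_d_etabar k f : smooth_on O f -> smooth_on O (d_etabar k f).
Proof. exact: smooth_cder (d_etabar_cder k). Qed.

Lemma d_etaJ k f q : smooth_on O f -> O q ->
  d_eta k (fun x => (f x)^*) q = (d_etabar k f q)^*.
Proof. exact: wirtingerJ. Qed.
Lemma d_etabarJ k f q : smooth_on O f -> O q ->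
  d_etabar k (fun x => (f x)^*) q = (d_eta k f q)^*.
Proof. exact: wirtinger_barJ. Qed.
Lemma d_zJ k f q : smooth_on O f -> O q ->
  d_z k (fun x => (f x)^*) q = (d_zbar k f q)^*.
Proof. exact: wirtingerJ. Qed.
Lemma d_zbarJ k f q : smooth_on O f -> O q ->
  d_zbar k (fun x => (f x)^*) q = (d_z k f q)^*.
Proof. exact: wirtinger_barJ. Qed.

Lemma d_eta_coord k l q : d_eta k (y l) q = (l == k)%:R.
Proof. by rewrite /d_eta wirtinger_coord mxE. Qed.
Lemma d_etabar_coord k l q : d_etabar k (y l) q = 0.
Proof. exact: wirtinger_bar_coord. Qed.
Lemma d_z_coord k l q : d_z k (y l) q = 0.
Proof. by rewrite /d_z wirtinger_coord mxE. Qed.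
Lemma smooth_coordJ k : smooth_on O (fun q => (y k q)^*).
Proof. by apply: (smoothJ oO); exact: smooth_coord. Qed.

Lemma eq_homogeneous (c c' : C -> C) f : (forall la, la != 0 -> c la = c' la) ->
  homogeneous_as U c f -> homogeneous_as U c' f.
Proof. by move=> cc' cf z eta la la0 Oq; rewrite cf // cc'. Qed.

Lemma homogeneousM (c c' : C -> C) f f' : homogeneous_as U c f ->
  homogeneous_as U c' f' -> homogeneous_as U (fun la => c la * c' la)
    (fun q => f q * f' q).
Proof. by move=> cf cf' z eta la la0 Oq; rewrite cf // cf' // mulrACA. Qed.

Lemma homogeneousD (c : C -> C) f f' : homogeneous_as U c f ->
  homogeneous_as U c f' -> homogeneous_as U c (fun q => f q + f' q).
Proof. by move=> cf cf' z eta la la0 Oq; rewrite cf // cf' // mulrDr. Qed.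

Lemma homogeneousN (c : C -> C) f : homogeneous_as U c f ->
  homogeneous_as U c (fun q => - f q).
Proof. by move=> cf z eta la la0 Oq; rewrite cf // mulrN. Qed.

Lemma homogeneous_sum (c : C -> C) (F : 'I_n -> TC -> C) :
  (forall i, homogeneous_as U c (F i)) ->
  homogeneous_as U c (fun q => \sum_i F i q).
Proof.
move=> cF z eta la la0 Oq; rewrite mulr_sumr; apply: eq_bigr => i _.
exact: cF.
Qed.

Lemma homogeneous_coord k : homogeneous_as U id (y k).
Proof. by move=> z eta la la0 Oq; rewrite /fibre_coord mxE. Qed.

(** The derivatives at 1 of the degree functions, taken in the directions 1 and i, are the constants
    a and b of Euler's relations. *)
Lemma degree_id (e : C) : has_rderive (id : C^o -> C) (e : C^o) (1 : C^o) e.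
Proof. by apply: rderive_affine => t. Qed.

Lemma degree_conj (e : C) : has_rderive (Num.conj : C^o -> C) (e : C^o) (1 : C^o) e^*.
Proof. exact: has_rderiveJ (degree_id e). Qed.

Lemma degree_sqr (e : C) :
  has_rderive ((fun la => la * la) : C^o -> C) (e : C^o) (1 : C^o) (2 * e).
Proof.
apply: has_rderive_eq (has_rderiveM (degree_id e) (degree_id e)) _.
by rewrite mulr1 mul1r mulr_natl mulr2n.
Qed.

Lemma cplx_ii : 'i * 'i = -1 :> C. Proof. by rewrite -expr2 sqrCi. Qed.

Lemma euler_degree1 f q : smooth_on O f -> homogeneous_as U id f -> O q ->
  \sum_k d_eta k f q * y k q = f q.
Proof.
case: q => z eta hf cf Oq.
rewrite (euler_d_eta oU hf cf Oq (degree_id 1) (degree_id 'i)) cplx_ii opprK.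
by rewrite -[1 + 1]/(2%:R) mulVf ?mul1r // pnatr_eq0.
Qed.

Lemma euler_degree1_bar f q : smooth_on O f -> homogeneous_as U id f -> O q ->
  \sum_k d_etabar k f q * (y k q)^* = 0.
Proof.
case: q => z eta hf cf Oq.
rewrite (euler_d_etabar oU hf cf Oq (degree_id 1) (degree_id 'i)) cplx_ii subrr.
by rewrite mulr0 mul0r.
Qed.

Lemma euler_degree_conj f q : smooth_on O f -> homogeneous_as U Num.conj f ->
  O q -> \sum_k d_etabar k f q * (y k q)^* = f q.
Proof.
case: q => z eta hf cf Oq.
rewrite (euler_d_etabar oU hf cf Oq (degree_conj 1) (degree_conj 'i)).
rewrite conjC1 conjCi mulrN cplx_ii opprK.
by rewrite -[1 + 1]/(2%:R) mulVf ?mul1r // pnatr_eq0.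
Qed.

Lemma euler_degree2 f q : smooth_on O f ->
  homogeneous_as U (fun la => la * la) f -> O q ->
  \sum_k d_eta k f q * y k q = 2 * f q.
Proof.
case: q => z eta hf cf Oq.
rewrite (euler_d_eta oU hf cf Oq (degree_sqr 1) (degree_sqr 'i)).
rewrite mulrCA cplx_ii; congr (_ * _); rewrite mulrN1 opprK mulr1.
by rewrite -mulr2n -[2 *+ 2]mulr_natl mulKf // pnatr_eq0.
Qed.

(** * Regularity, symmetry and degrees of the metric, the spray and the connection *)

Variable L : TC -> C.
Hypothesis hL : smooth_on O L.
Hypothesis L_real : forall q, (L q)^* = L q.
Hypothesis L_hom : homogeneous_as U (fun la => la * la^*) L.
Hypothesis L_pos : forall q, O q -> forall xi : 'rV[C]_n, xi != 0 ->
  0 < \sum_i \sum_j metric L i j q * xi 0 i * (xi 0 j)^*.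

Lemma smooth_metric i j : smooth_on O (metric L i j).
Proof. by apply: smooth_d_eta; apply: smooth_d_etabar. Qed.

Lemma smooth_cartan i j k : smooth_on O (cartan L i j k).
Proof. by apply: smooth_d_eta; apply: smooth_metric. Qed.

(** A nonzero vector in the left kernel would be null for the positive definite form. *)
Lemma metric_unit q : O q -> \matrix_(k, j') metric L k j' q \in unitmx.
Proof.
move=> Oq; rewrite unitmxE unitfE; apply/negP => /det0P [xi xi0 xiA].
have := L_pos Oq xi0; rewrite exchange_big /= big1 ?ltxx // => j _.
have := congr1 (fun A : 'rV[C]_n => A 0 j) xiA; rewrite !mxE => E.
rewrite -mulr_suml; have -> : \sum_i metric L i j q * xi 0 i = 0.
  by apply: etrans E; apply: eq_bigr => i _; rewrite mxE mulrC.
by rewrite mul0r.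
Qed.

Lemma smooth_inv_metric j i : smooth_on O (inv_metric L j i).
Proof.
apply: (smooth_invmx oO); first exact: metric_unit.
move=> k l; apply: (eq_smooth oO) (smooth_metric k l) => q _.
by rewrite mxE.
Qed.

Lemma smooth_cf_connection i j : smooth_on O (cf_connection L i j).
Proof.
apply: (smooth_sum oO) => m _; apply: (smooth_sum oO) => l _.
apply: (smoothM oO); last exact: smooth_coord.
apply: (smoothM oO); first exact: smooth_inv_metric.
by apply: smooth_d_z; exact: smooth_metric.
Qed.

Lemma smooth_spray i : smooth_on O (spray L i).
Proof.
apply: (smoothM oO); first exact: smooth_cst.
apply: (smooth_sum oO) => j _; apply: (smoothM oO); last exact: smooth_coord.
exact: smooth_cf_connection.
Qed.

Lemma smooth_c_connection i j : smooth_on O (c_connection L i j).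
Proof. by apply: smooth_d_eta; exact: smooth_spray. Qed.

Lemma smooth_berwald i j k : smooth_on O (berwald L i j k).
Proof. by apply: smooth_d_eta; exact: smooth_c_connection. Qed.

Lemma inv_metricK q j k : O q ->
  \sum_i inv_metric L j i q * metric L i k q = (j == k)%:R.
Proof.
move=> Oq; have := congr1 (fun A : 'M[C]_n => A j k) (mulVmx (metric_unit Oq)).
by rewrite !mxE => <-; apply: eq_bigr => i _; rewrite mxE.
Qed.

Lemma d_etaL_J j q : O q -> (d_etabar j L q)^* = d_eta j L q.
Proof.
move=> Oq; rewrite -(d_etaJ j hL Oq).
have -> // : (fun x => (L x)^*) = L by apply/funext => x; rewrite L_real.
Qed.

Lemma metricJ i j q : O q -> (metric L i j q)^* = metric L j i q.
Proof.
move=> Oq; rewrite -d_etabarJ //; last exact: smooth_d_etabar.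
rewrite (eq_cder oO (g := d_eta j L) (d_etabar_cder i)) //.
- by rewrite (cderC oO (d_etabar_cder i) (d_eta_cder j)).
- by apply: (smoothJ oO); exact: smooth_d_etabar.
- by move=> x Ox; rewrite d_etaL_J.
Qed.

Lemma homogeneous_d_etaL j : homogeneous_as U Num.conj (d_eta j L).
Proof.
apply: eq_homogeneous (homogeneous_d_eta oU j hL L_hom) => la la0 /=.
by rewrite mulrAC divff // mul1r.
Qed.

Lemma homogeneous_d_etabarL j : homogeneous_as U id (d_etabar j L).
Proof.
apply: eq_homogeneous (homogeneous_d_etabar oU j hL L_hom) => la la0 /=.
by rewrite -mulrA divff ?mulr1 // conjC_eq0.
Qed.

Lemma homogeneous_metric i j : homogeneous_as U (fun=> 1) (metric L i j).
Proof.
apply: eq_homogeneous (homogeneous_d_eta oU i (smooth_d_etabar j hL)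
  (homogeneous_d_etabarL j)) => la la0 /=.
by rewrite divff.
Qed.

Lemma homogeneous_inv_metric j i : homogeneous_as U (fun=> 1) (inv_metric L j i).
Proof.
move=> z eta la la0 Oq; rewrite mul1r; apply: eq_invmx => k l.
exact: etrans (@homogeneous_metric k l z eta la la0 Oq) (mul1r _).
Qed.

Lemma homogeneous_cf_connection i j : homogeneous_as U id (cf_connection L i j).
Proof.
apply: homogeneous_sum => m; apply: homogeneous_sum => l.
have h := homogeneous_d_z oU j (@smooth_metric l m) (@homogeneous_metric l m).
apply: eq_homogeneous (homogeneousM (homogeneousM (homogeneous_inv_metric m i) h)
  (homogeneous_coord l)) => la la0 /=.
by rewrite !mul1r.
Qed.

Lemma homogeneous_spray i : homogeneous_as U (fun la => la * la) (spray L i).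
Proof.
have hs : homogeneous_as U (fun la => la * la)
    (fun q => \sum_j cf_connection L i j q * q.2 0 j).
  apply: homogeneous_sum => j.
  exact: (homogeneousM (homogeneous_cf_connection i j) (homogeneous_coord j)).
by move=> z eta la la0 Oq; rewrite /spray (hs z eta la la0 Oq) mulrCA.
Qed.

Lemma homogeneous_c_connection i j : homogeneous_as U id (c_connection L i j).
Proof.
apply: eq_homogeneous (homogeneous_d_eta oU j (smooth_spray i)
  (homogeneous_spray i)) => la la0 /=.
by rewrite mulfK.
Qed.

Lemma homogeneous_berwald i j k : homogeneous_as U (fun=> 1) (berwald L i j k).
Proof.
apply: eq_homogeneous (homogeneous_d_eta oU k (smooth_c_connection i j)
  (homogeneous_c_connection i j)) => la la0 /=.
by rewrite divff.
Qed.

Lemma metric_etabar j q : O q ->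
  \sum_r metric L j r q * (y r q)^* = d_eta j L q.
Proof.
move=> Oq; rewrite -(euler_degree_conj (smooth_d_eta j hL) (homogeneous_d_etaL j) Oq).
by apply: eq_bigr => r _; rewrite (cderC oO (d_etabar_cder r) (d_eta_cder j)).
Qed.

Lemma metric_eta m q : O q -> \sum_l metric L l m q * y l q = d_etabar m L q.
Proof.
move=> Oq.
by rewrite -(euler_degree1 (smooth_d_etabar m hL) (homogeneous_d_etabarL m) Oq).
Qed.

Lemma c_connection_eta i q : O q ->
  \sum_j c_connection L i j q * y j q = 2 * spray L i q.
Proof. exact: euler_degree2 (smooth_spray i) (homogeneous_spray i). Qed.

Lemma berwald_eta i j q : O q ->
  \sum_k berwald L i j k q * y k q = c_connection L i j q.
Proof. exact: euler_degree1 (smooth_c_connection i j) (homogeneous_c_connection i j). Qed.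

Lemma berwald_ub_etabar i j q : O q ->
  \sum_k berwald_ub L i j k q * (y k q)^* = 0.
Proof.
exact: euler_degree1_bar (smooth_c_connection i j) (homogeneous_c_connection i j).
Qed.

(** Both sides are second eta-derivatives of [spray L i]. *)
Lemma berwaldC i j k q : O q -> berwald L i j k q = berwald L i k j q.
Proof.
move=> Oq; rewrite /berwald /c_connection.
by rewrite (cderC oO (d_eta_cder k) (d_eta_cder j) (smooth_spray i) Oq).
Qed.

Lemma cderM0 (D : (TC -> C) -> TC -> C) f f' q : complex_derivation D ->
  smooth_on O f -> smooth_on O f' -> O q -> D f' q = 0 ->
  D (fun x => f x * f' x) q = D f q * f' q.
Proof. by move=> hD hf hf' Oq E; rewrite (cderM hD hf hf' Oq) E mulr0 addr0. Qed.

Lemma d_eta_coordJ k l q : O q -> d_eta k (fun x => (y l x)^*) q = 0.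
Proof. by move=> Oq; rewrite (d_etaJ k (smooth_coord oU l) Oq) d_etabar_coord conjC0. Qed.

Lemma d_etabar_coordJ k l q : O q ->
  d_etabar k (fun x => (y l x)^*) q = (l == k)%:R.
Proof.
move=> Oq; rewrite (d_etabarJ k (smooth_coord oU l) Oq) d_eta_coord.
exact: rmorph_nat.
Qed.

Lemma d_zbar_coordJ k l q : O q -> d_zbar k (fun x => (y l x)^*) q = 0.
Proof. by move=> Oq; rewrite (d_zbarJ k (smooth_coord oU l) Oq) d_z_coord conjC0. Qed.

Lemma metricE i j : metric L i j = d_eta i (d_etabar j L). Proof. by []. Qed.
Lemma cartanE i j k : cartan L i j k = d_eta k (metric L i j). Proof. by []. Qed.
Lemma c_connectionE i j : c_connection L i j = d_eta j (spray L i).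
Proof. by []. Qed.
Lemma berwaldE i j k : berwald L i j k = d_eta k (c_connection L i j).
Proof. by []. Qed.
Lemma berwald_ubE i j k : berwald_ub L i j k = d_etabar k (c_connection L i j).
Proof. by []. Qed.

Opaque d_eta d_etabar d_z d_zbar metric cartan inv_metric c_connection berwald.
Opaque berwald_ub fibre_coord.

Lemma cder_eq0 (D : (TC -> C) -> TC -> C) f q : complex_derivation D ->
  (forall q, O q -> f q = 0) -> O q -> D f q = 0.
Proof.
move=> hD f0 Oq; rewrite -(eq_cder oO hD (smooth_cst oO 0) _ Oq).
  exact: cder_cst.
by move=> x Ox; rewrite f0.
Qed.

Lemma cder_sumE (D : (TC -> C) -> TC -> C) (F : 'I_n -> TC -> C) f q :
  complex_derivation D -> (forall i, smooth_on O (F i)) ->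
  (forall x, O x -> \sum_i F i x = f x) -> O q -> D f q = \sum_i D (F i) q.
Proof.
move=> hD sF Ff Oq; rewrite -(eq_cder oO hD _ Ff Oq); first exact: (cder_sum oO).
exact: (smooth_sum oO).
Qed.

(** * Exchange of summations in contracted tensors *)

Lemma mul4AC (a b c d : C) : a * b * c * d = a * d * (b * c).
Proof. by ring. Qed.

Lemma contract_sum (a : 'I_n -> 'I_n -> C) (x v : 'I_n -> C) :
  \sum_k (\sum_m a m k * x m) * v k = \sum_m (\sum_k a m k * v k) * x m.
Proof.
under eq_bigr do rewrite mulr_suml.
rewrite exchange_big; apply: eq_bigr => m _; rewrite mulr_suml.
by apply: eq_bigr => k _; rewrite mulrAC.
Qed.

Lemma contract_sum4 (a v x1 x2 x3 x4 : 'I_n -> C) (b1 b2 b3 b4 : 'I_n -> 'I_n -> C) :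
  \sum_k (a k - \sum_m b1 m k * x1 m - \sum_m b2 m k * x2 m
    - \sum_m b3 m k * x3 m - \sum_m b4 m k * x4 m) * v k =
  \sum_k a k * v k - \sum_m (\sum_k b1 m k * v k) * x1 m
    - \sum_m (\sum_k b2 m k * v k) * x2 m - \sum_m (\sum_k b3 m k * v k) * x3 m
    - \sum_m (\sum_k b4 m k * v k) * x4 m.
Proof.
rewrite -(contract_sum b1) -(contract_sum b2) -(contract_sum b3) -(contract_sum b4).
by rewrite -!sumrB; apply: eq_bigr => k _; rewrite !mulrBl.
Qed.

Lemma contract_sum2 (v s x : 'I_n -> C) (a b c : 'I_n -> 'I_n -> C) :
  \sum_r (\sum_k a k r * v k - \sum_m s m * b m r - \sum_m c m r * x m) * v r =
  \sum_k (\sum_r a k r * v r) * v k - \sum_m (\sum_r b m r * v r) * s m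
    - \sum_m (\sum_r c m r * v r) * x m.
Proof.
rewrite -(contract_sum a) -(contract_sum b) -(contract_sum c) -!sumrB.
apply: eq_bigr => r _; rewrite !mulrBl; congr (_ - _ * _ - _).
by apply: eq_bigr => m _; rewrite mulrC.
Qed.

Lemma eq_sub (a a' b b' c c' : C) : a = a' -> b = b' -> c = c' ->
  a - b - c = a' - b' - c'.
Proof. by move=> -> -> ->. Qed.

Lemma eq_sub4 (a b c d : C) : a - (b + c) - d = a - c - d - b.
Proof. by ring. Qed.

Lemma eq_sub5 (a a' b b' c c' d d' : C) : a = a' -> b = b' -> c = c' -> d = d' ->
  a - b - c - d = a' - b' - c' - d'.
Proof. by move=> -> -> -> ->. Qed.

Lemma sub_eq0 (a b : C) : b = 0 -> a - b = a.
Proof. by move=> ->; rewrite subr0. Qed.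

Lemma conj_sub_eq0 (a b c d e : C) : c = 0 -> e = 0 ->
  (a - b - c - d - e)^* = a^* - b^* - d^*.
Proof. by move=> -> ->; rewrite !subr0 !conjB. Qed.

Lemma big_mul0 (a x : 'I_n -> C) : (forall m, a m = 0) -> \sum_m a m * x m = 0.
Proof. by move=> a0; rewrite big1 // => m _; rewrite a0 mul0r. Qed.

Lemma eq_big_mul (a a' x : 'I_n -> C) : (forall m, a m = a' m) ->
  \sum_m a m * x m = \sum_m a' m * x m.
Proof. by move=> aa'; apply: eq_bigr => m _; rewrite aa'. Qed.

Lemma sum_delta (x : 'I_n -> C) m : \sum_r (r == m)%:R * x r = x m.
Proof.
rewrite (bigD1 m) //= eqxx mul1r big1 ?addr0 // => r rm.
by rewrite (negbTE rm) mul0r.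
Qed.

(** * The spray relation and contractions of the Cartan tensor *)

Lemma d_z_d_etabarL j m q : O q ->
  d_z j (d_etabar m L) q = \sum_l d_z j (metric L l m) q * y l q.
Proof.
move=> Oq; have sm l : smooth_on O (fun x => metric L l m x * y l x).
  by apply: (smoothM oO); [exact: smooth_metric|exact: smooth_coord].
rewrite (cder_sumE (d_z_cder j) sm (metric_eta m) Oq); apply: eq_bigr => l _.
exact: (cderM0 (d_z_cder j) (smooth_metric l m) (smooth_coord oU l) Oq (d_z_coord j l q)).
Qed.

(** Lowering the index i cancels the inverse metric in the definition of N^i_j. *)
Lemma cf_connection_metric j m q : O q ->
  \sum_i cf_connection L i j q * metric L i m q =
  \sum_l d_z j (metric L l m) q * y l q.
Proof.
move=> Oq.
transitivity (\sum_i \sum_m' inv_metric L m' i q * metric L i m q *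
    \sum_l d_z j (metric L l m') q * y l q).
  apply: eq_bigr => i _; rewrite /cf_connection mulr_suml.
  apply: eq_bigr => m' _.
  rewrite mulr_suml.
  rewrite mulr_sumr.
  apply: eq_bigr => l _; rewrite -[q.2 0 l]/(y l q).
  exact: mul4AC.
rewrite exchange_big /= -[RHS](sum_delta (fun m' => \sum_l _ * _) m).
by apply: eq_bigr => m' _; rewrite -mulr_suml inv_metricK.
Qed.

Lemma spray_metric m q : O q ->
  \sum_i 2 * spray L i q * metric L i m q = \sum_j d_z j (d_etabar m L) q * y j q.
Proof.
move=> Oq.
transitivity (\sum_i (\sum_j cf_connection L i j q * y j q) * metric L i m q).
  by apply: eq_bigr => i _; rewrite /spray mulVKf ?pnatr_eq0.
rewrite -(contract_sum (fun i j => cf_connection L i j q)).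
by apply: eq_bigr => j _; rewrite d_z_d_etabarL // cf_connection_metric.
Qed.

Opaque spray cf_connection.

Lemma conj2 : (2 : C)^* = 2. Proof. exact: rmorph_nat. Qed.

Lemma sprayJ_metric j q : O q ->
  \sum_i 2 * (spray L i q)^* * metric L j i q =
  \sum_k d_zbar k (d_eta j L) q * (y k q)^*.
Proof.
move=> Oq; have := congr1 Num.conj (spray_metric j Oq); rewrite !conj_sum.
have -> : \sum_i (2 * spray L i q * metric L i j q)^* =
    \sum_i 2 * (spray L i q)^* * metric L j i q.
  apply: eq_bigr => i _.
  by rewrite conjM [(2 * _)^*]conjM (metricJ i j Oq) conj2.
move=> ->; apply: eq_bigr => k _; rewrite conjM; congr (_ * _).
rewrite -(d_zbarJ k (smooth_d_etabar j hL) Oq).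
apply: (eq_cder oO (d_zbar_cder k)) => //; last by move=> x; exact: d_etaL_J.
by apply: (smoothJ oO); exact: smooth_d_etabar.
Qed.

Lemma smooth_sprayJ i : smooth_on O (fun q => 2 * (spray L i q)^*).
Proof.
apply: (smoothM oO); first exact: smooth_cst.
by apply: (smoothJ oO); exact: smooth_spray.
Qed.

(** The conjugate spray relation differentiated in eta^h. The conjugate spray contributes the first
    sum, the metric the second; the coordinates etabar^k are constants. *)
Lemma d_eta_sprayJ_metric h j q : O q ->
  \sum_i 2 * (d_etabar h (spray L i) q)^* * metric L j i q +
  \sum_i 2 * (spray L i q)^* * cartan L j i h q =
  \sum_k d_zbar k (d_eta h (d_eta j L)) q * (y k q)^*.
Proof.
move=> Oq; have hd := d_eta_cder h; have sj := smooth_d_eta j hL.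
have s1 i : smooth_on O (fun x => 2 * (spray L i x)^* * metric L j i x).
  by apply: (smoothM oO); [exact: smooth_sprayJ|exact: smooth_metric].
have s2 k : smooth_on O (fun x => d_zbar k (d_eta j L) x * (y k x)^*).
  by apply: (smoothM oO); [exact: smooth_d_zbar|exact: smooth_coordJ].
have := cder_sumE hd s1 (sprayJ_metric j) Oq; rewrite (cder_sum oO _ _ hd s2 Oq).
have -> : \sum_i d_eta h (fun x => 2 * (spray L i x)^* * metric L j i x) q =
    \sum_i 2 * (d_etabar h (spray L i) q)^* * metric L j i q +
    \sum_i 2 * (spray L i q)^* * cartan L j i h q.
  rewrite -big_split; apply: eq_bigr => i _ /=.
  rewrite (cderM hd (smooth_sprayJ i) (smooth_metric j i) Oq).
  rewrite (cderZ oO 2 hd (smoothJ oO (smooth_spray i)) Oq).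
  by rewrite (d_etaJ h (smooth_spray i) Oq) cartanE.
move=> <-; apply: eq_bigr => k _.
rewrite (cderM0 hd (smooth_d_zbar k sj) (smooth_coordJ k) Oq (d_eta_coordJ h k Oq)).
by rewrite (cderC oO hd (d_zbar_cder k) sj Oq).
Qed.

Lemma cartan_etabar j h q : O q ->
  \sum_r cartan L j r h q * (y r q)^* = d_eta h (d_eta j L) q.
Proof.
move=> Oq; have hd := d_eta_cder h.
have s1 r : smooth_on O (fun x => metric L j r x * (y r x)^*).
  by apply: (smoothM oO); [exact: smooth_metric|exact: smooth_coordJ].
rewrite (cder_sumE hd s1 (metric_etabar j) Oq); apply: eq_bigr => r _.
rewrite cartanE.
by rewrite (cderM0 hd (smooth_metric j r) (smooth_coordJ r) Oq (d_eta_coordJ h r Oq)).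
Qed.

Lemma smooth_cartan_etabar j h r :
  smooth_on O (fun x => cartan L j r h x * (y r x)^*).
Proof. by apply: (smoothM oO); [exact: smooth_cartan|exact: smooth_coordJ]. Qed.

Lemma d_zbar_cartan_etabar j h k q : O q ->
  \sum_r d_zbar k (cartan L j r h) q * (y r q)^* = d_zbar k (d_eta h (d_eta j L)) q.
Proof.
move=> Oq; have hd := d_zbar_cder k.
apply: etrans _ (esym (@cder_sumE _ (fun r x => cartan L j r h x * (y r x)^*)
  (d_eta h (d_eta j L)) q hd (@smooth_cartan_etabar j h)
  (fun x => @cartan_etabar j h x) Oq)).
apply: eq_bigr => r _.
by rewrite (cderM0 hd (smooth_cartan j r h) (smooth_coordJ r) Oq (d_zbar_coordJ k r Oq)).
Qed.

(** Differentiate [cartan_etabar] in etabar^m: the coordinate factor already yields C_{j mbar h},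
    which is also the whole right-hand side, so the remaining sum is 0. *)
Lemma d_etabar_cartan_etabar j h m q : O q ->
  \sum_r d_etabar m (cartan L j r h) q * (y r q)^* = 0.
Proof.
move=> Oq; have hd := d_etabar_cder m; have sj := smooth_d_eta j hL.
have : d_etabar m (d_eta h (d_eta j L)) q = cartan L j m h q.
  rewrite (cderC oO hd (d_eta_cder h) sj Oq) cartanE metricE.
  apply: (eq_cder oO (d_eta_cder h)) => //; first exact: smooth_d_etabar.
  by move=> x Ox; rewrite (cderC oO hd (d_eta_cder j) hL Ox).
have E := @cder_sumE _ (fun r x => cartan L j r h x * (y r x)^*)
  (d_eta h (d_eta j L)) q hd (@smooth_cartan_etabar j h)
  (fun x => @cartan_etabar j h x) Oq.
move=> E'; move: (etrans (esym E) E').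
have -> : \sum_r d_etabar m (fun x => cartan L j r h x * (y r x)^*) q =
    \sum_r d_etabar m (cartan L j r h) q * (y r q)^* +
    \sum_r (r == m)%:R * cartan L j r h q.
  rewrite -big_split; apply: eq_bigr => r _ /=.
  rewrite (cderM hd (smooth_cartan j r h) (smooth_coordJ r) Oq).
  rewrite (d_etabar_coordJ m r Oq).
  by rewrite [cartan _ _ _ _ _ * _%:R]mulrC.
by rewrite sum_delta => /eqP; rewrite -subr_eq0 addrK => /eqP.
Qed.

Lemma c_connectionJ_etabar m q : O q ->
  \sum_k (c_connection L m k q)^* * (y k q)^* = 2 * (spray L m q)^*.
Proof.
move=> Oq; have := congr1 Num.conj (c_connection_eta m Oq).
rewrite conj_sum conjM conj2 => <-.
by apply: eq_bigr => k _; rewrite conjM.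
Qed.

Lemma berwald_bb_etabar m r q : O q ->
  \sum_k berwald_bb L m r k q * (y k q)^* = (c_connection L m r q)^*.
Proof.
move=> Oq; rewrite -(berwald_eta m r Oq) conj_sum.
by apply: eq_bigr => k _; rewrite conjM.
Qed.

(** The connection is homogeneous of degree la, so by Euler its mixed Berwald coefficients contract
    to 0 with etabar, and the conjugate pure ones contract to the conjugate connection. *)
Lemma cartan_hbar0E j r h q : O q -> cartan_hbar0 L j r h q =
  \sum_k d_zbar k (cartan L j r h) q * (y k q)^* -
  \sum_m 2 * (spray L m q)^* * d_etabar m (cartan L j r h) q -
  \sum_m (c_connection L m r q)^* * cartan L j m h q.
Proof.
move=> Oq.
apply: etrans (contract_sum4 (fun k => d_zbar k (cartan L j r h) q)
  (fun k => (y k q)^*) (fun m => d_etabar m (cartan L j r h) q)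
  (fun m => cartan L m r h q) (fun m => cartan L j m h q)
  (fun m => cartan L j r m q) (fun m k => (c_connection L m k q)^*)
  (fun m k => berwald_ub L m j k q) (fun m k => berwald_bb L m r k q)
  (fun m k => berwald_ub L m h k q)) _.
rewrite [X in _ - X - _ - _](big_mul0 _ (fun m => @berwald_ub_etabar m j q Oq)).
rewrite [X in _ - X](big_mul0 _ (fun m => @berwald_ub_etabar m h q Oq)) !subr0.
apply: eq_sub; first by [].
  by apply: eq_big_mul => m; exact: c_connectionJ_etabar.
by apply: eq_big_mul => m; exact: berwald_bb_etabar.
Qed.

(** Under contraction with etabar^r the middle sum of [cartan_hbar0E] dies by
    [d_etabar_cartan_etabar]. The other two become terms of [d_eta_sprayJ_metric], whose remaining
    term is the right-hand side. *)
Lemma cartan_hbar0_etabar j h q : O q ->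
  \sum_r cartan_hbar0 L j r h q * (y r q)^* =
  \sum_i 2 * (d_etabar h (spray L i) q)^* * metric L j i q.
Proof.
move=> Oq; apply: etrans (eq_big_mul _ (fun r => @cartan_hbar0E j r h q Oq)) _.
apply: etrans (contract_sum2 (fun k => (y k q)^*) (fun m => 2 * (spray L m q)^*)
  (fun m => cartan L j m h q) (fun k r => d_zbar k (cartan L j r h) q)
  (fun m r => d_etabar m (cartan L j r h) q) (fun m r => (c_connection L m r q)^*)) _.
rewrite [X in _ - X - _](big_mul0 _ (fun m => @d_etabar_cartan_etabar j h m q Oq)).
rewrite subr0 [X in X - _](eq_big_mul _ (fun k => @d_zbar_cartan_etabar j h k q Oq)).
rewrite [X in _ - X](eq_big_mul _ (fun m => @c_connectionJ_etabar m q Oq)).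
by apply/eqP; rewrite subr_eq; apply/eqP; rewrite d_eta_sprayJ_metric.
Qed.

Lemma spray_holomorphic q : O q ->
  (forall j r h, cartan_hbar0 L j r h q = 0) ->
  forall h i, d_etabar h (spray L i) q = 0.
Proof.
move=> Oq hbar0 h i.
pose a k := 2 * (d_etabar h (spray L k) q)^*.
have ga j : \sum_k metric L j k q * a k = 0.
  transitivity (\sum_r cartan_hbar0 L j r h q * (y r q)^*).
    by rewrite cartan_hbar0_etabar //; apply: eq_bigr => k _; rewrite mulrC.
  by rewrite big1 // => r _; rewrite hbar0 mul0r.
have : a i = 0.
  rewrite -(sum_delta a i).
  transitivity (\sum_k \sum_j inv_metric L i j q * (metric L j k q * a k)).
    apply: eq_bigr => k _; rewrite eq_sym -(inv_metricK i k Oq) mulr_suml.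
    by apply: eq_bigr => j _; rewrite mulrA.
  rewrite exchange_big big1 // => j _ /=.
  by rewrite -mulr_sumr ga mulr0.
move=> /eqP; rewrite /a mulf_eq0 pnatr_eq0 /= conjC_eq0.
by move=> /eqP.
Qed.

(** By Hermitian symmetry of the metric, conjugation turns C_{r lbar h} into the other Cartan tensor
    C_{l rbar hbar}. *)
Lemma cartanJ r l h q : O q -> (cartan L r l h q)^* = d_etabar h (metric L l r) q.
Proof.
move=> Oq; rewrite cartanE -(d_etabarJ h (smooth_metric r l) Oq).
apply: (eq_cder oO (d_etabar_cder h)) => //; last by move=> x; exact: metricJ.
by apply: (smoothJ oO); exact: smooth_metric.
Qed.

(** * The covariant derivative of the metric when the spray is holomorphic in eta *)

Section holomorphic_spray.
Hypothesis spray_hol : forall h i q, O q -> d_etabar h (spray L i) q = 0.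

Lemma c_connection_hol h i j q : O q -> d_etabar h (c_connection L i j) q = 0.
Proof.
move=> Oq; rewrite c_connectionE.
apply: etrans (cderC oO (d_etabar_cder h) (d_eta_cder j) (smooth_spray i) Oq) _.
exact: (cder_eq0 (d_eta_cder j) (fun x => @spray_hol h i x) Oq).
Qed.

Lemma berwald_ub_eq0 i j k q : O q -> berwald_ub L i j k q = 0.
Proof. by move=> Oq; rewrite berwald_ubE; exact: c_connection_hol. Qed.

Lemma berwald_bu_eq0 i j k q : O q -> berwald_bu L i j k q = 0.
Proof. by move=> Oq; rewrite /berwald_bu berwald_ub_eq0 // conjC0. Qed.

Lemma berwald_hol h i j k q : O q -> d_etabar h (berwald L i j k) q = 0.
Proof.
move=> Oq; rewrite berwaldE.
apply: etrans (cderC oO (d_etabar_cder h) (d_eta_cder k)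
  (smooth_c_connection i j) Oq) _.
exact: (cder_eq0 (d_eta_cder k) (fun x => @c_connection_hol h i j x) Oq).
Qed.

Lemma d_eta_berwald h i j k q : O q -> d_eta h (berwald L i j k) q = 0.
Proof.
exact: (holomorphic_degree0 oU (smooth_berwald i j k) (homogeneous_berwald i j k)
  (fun h x => @berwald_hol h i j k x)).
Qed.

(* g_{l rbar | s} without its mixed Berwald term, which vanishes here. *)
Definition metric_hol_h l r s q : C :=
  d_z s (metric L l r) q
  - \sum_j c_connection L j s q * d_eta j (metric L l r) q
  - \sum_m berwald L m l s q * metric L m r q.

Lemma metric_hE l r s q : O q -> metric_h L l r s q = metric_hol_h l r s q.
Proof.
move=> Oq; rewrite /metric_h /c_delta /metric_hol_h.
apply: sub_eq0; exact: (big_mul0 _ (fun m => @berwald_bu_eq0 m r s q Oq)).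
Qed.

Lemma smooth_connection_term l r s j :
  smooth_on O (fun q => c_connection L j s q * d_eta j (metric L l r) q).
Proof.
apply: (smoothM oO); first exact: smooth_c_connection.
by apply: smooth_d_eta; exact: smooth_metric.
Qed.

Lemma smooth_berwald_term l r s m :
  smooth_on O (fun q => berwald L m l s q * metric L m r q).
Proof. by apply: (smoothM oO); [exact: smooth_berwald|exact: smooth_metric]. Qed.

Lemma smooth_metric_hol_h l r s : smooth_on O (metric_hol_h l r s).
Proof.
apply: (smoothB oO); first apply: (smoothB oO).
- by apply: smooth_d_z; exact: smooth_metric.
- by apply: (smooth_sum oO) => j _; exact: smooth_connection_term.
- by apply: (smooth_sum oO) => m _; exact: smooth_berwald_term.
Qed.

Lemma homogeneous_metric_hol_h l r s : homogeneous_as U (fun=> 1) (metric_hol_h l r s).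
Proof.
have hg m := @homogeneous_metric m r.
apply: homogeneousD; first apply: homogeneousD.
- exact: homogeneous_d_z (smooth_metric l r) (hg l).
- apply: homogeneousN; apply: homogeneous_sum => j.
  have hd := homogeneous_d_eta oU j (@smooth_metric l r) (hg l).
  apply: eq_homogeneous (homogeneousM (homogeneous_c_connection j s) hd) => la la0 /=.
  by rewrite mul1r divff.
- apply: homogeneousN; apply: homogeneous_sum => m.
  apply: eq_homogeneous (homogeneousM (homogeneous_berwald m l s) (hg m)) => la la0 /=.
  by rewrite mul1r.
Qed.

(** One computation for both d / d eta^h and d / d etabar^h: each annihilates the Berwald
    coefficients, which here depend only on z. *)
Lemma cder_metric_hol_h (D : (TC -> C) -> TC -> C) l r s q :
  complex_derivation D -> O q ->
  (forall i j k, D (berwald L i j k) q = 0) ->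
  D (metric_hol_h l r s) q =
  d_z s (D (metric L l r)) q
  - (\sum_j D (c_connection L j s) q * d_eta j (metric L l r) q
     + \sum_j c_connection L j s q * d_eta j (D (metric L l r)) q)
  - \sum_m berwald L m l s q * D (metric L m r) q.
Proof.
move=> hD Oq Db; have sg := smooth_metric l r.
have s0 := smooth_d_z s sg.
have s1 : smooth_on O (fun q => \sum_j
    c_connection L j s q * d_eta j (metric L l r) q).
  by apply: (smooth_sum oO) => j _; exact: smooth_connection_term.
have s2 : smooth_on O (fun q => \sum_m berwald L m l s q * metric L m r q).
  by apply: (smooth_sum oO) => m _; exact: smooth_berwald_term.
apply: etrans (cderB oO hD (smoothB oO s0 s1) s2 Oq) _.
rewrite (cderB oO hD s0 s1 Oq); apply: eq_sub.
- exact: (cderC oO hD (d_z_cder s) sg Oq).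
- rewrite (cder_sum oO _ _ hD (@smooth_connection_term l r s) Oq) -big_split.
  apply: eq_bigr => j _.
  apply: etrans (cderM hD (smooth_c_connection j s) (smooth_d_eta j sg) Oq) _.
  by rewrite (cderC oO hD (d_eta_cder j) sg Oq).
- rewrite (cder_sum oO _ _ hD (@smooth_berwald_term l r s) Oq).
  apply: eq_bigr => m _.
  apply: etrans (cderM hD (smooth_berwald m l s) (smooth_metric m r) Oq) _.
  by rewrite Db mul0r add0r.
Qed.

(** Differentiating the connection coefficient produces, by symmetry of L^i_{jk}, exactly the
    Berwald term that the covariant derivative subtracts for the new lower index h. *)
Lemma d_eta_metric_hol_h h l r s q : O q ->
  d_eta h (metric_hol_h l r s) q = cartan_h L l r h s q.
Proof.
move=> Oq; apply: etrans (cder_metric_hol_h l r s (d_eta_cder h) Oq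
  (fun i j k => @d_eta_berwald h i j k q Oq)) _.
apply: etrans (eq_sub4 _ _ _ _) _; rewrite /cartan_h.
apply: etrans _ (esym (congr1 (fun x => x - _) (sub_eq0 _
  (big_mul0 _ (fun m => @berwald_bu_eq0 m r s q Oq))))).
rewrite /c_delta; apply: eq_sub5.
- by rewrite cartanE.
- by apply: eq_bigr => j _; rewrite cartanE.
- by apply: eq_bigr => m _; rewrite cartanE.
- apply: eq_bigr => m _; rewrite [cartan L l r m]cartanE (berwaldC m h s Oq).
  by rewrite berwaldE.
Qed.

(** Here the derivative of the connection vanishes, which matches the vanishing mixed Berwald terms
    for the indices r and h on the other side. *)
Lemma d_etabar_metric_hol_h h l r s q : O q ->
  d_etabar h (metric_hol_h l r s) q = (cartan_hbar L r l h s q)^*.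
Proof.
move=> Oq; apply: etrans (cder_metric_hol_h l r s (d_etabar_cder h) Oq
  (fun i j k => @berwald_hol h i j k q Oq)) _.
apply: etrans _ (esym (conj_sub_eq0 _ _ _
  (big_mul0 _ (fun m => @berwald_ub_eq0 m r s q Oq))
  (big_mul0 _ (fun m => @berwald_ub_eq0 m h s q Oq)))).
apply: eq_sub.
- rewrite -(d_zJ s (smooth_cartan r l h) Oq).
  apply: (eq_cder oO (d_z_cder s)) => //; last by move=> x Ox; rewrite cartanJ.
  by apply: smooth_d_etabar; exact: smooth_metric.
- apply: etrans (congr1 (fun x => x + _)
    (big_mul0 _ (fun j => @c_connection_hol h j s q Oq))) _.
  rewrite add0r conj_sum; apply: eq_bigr => j _; rewrite conjM conjCK.
  rewrite -(d_etaJ j (smooth_cartan r l h) Oq); congr (_ * _).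
  apply: (eq_cder oO (d_eta_cder j)) => //; last by move=> x Ox; rewrite cartanJ.
  by apply: smooth_d_etabar; exact: smooth_metric.
- rewrite conj_sum; apply: eq_bigr => m _.
  by rewrite conjM cartanJ // /berwald_bb conjCK.
Qed.

Lemma metric_hol_h_holomorphic l r :
  (forall h q, O q -> cartan_h0 L l r h q = 0) ->
  (forall h q, O q -> cartan_hbar0 L r l h q = 0) ->
  forall k s q, O q -> d_etabar k (metric_hol_h l r s) q = 0.
Proof.
move=> h0 hbar0 k s q Oq.
pose F i := fun x => metric_hol_h l r i x * y i x.
have sF i : smooth_on O (F i).
  by apply: (smoothM oO); [exact: smooth_metric_hol_h|exact: smooth_coord].
pose phi := fun x => \sum_i F i x.
have sphi : smooth_on O phi by apply: (smooth_sum oO).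
have phi_eta h x : O x -> d_eta h phi x = metric_hol_h l r h x.
  move=> Ox; have hd := d_eta_cder h.
  apply: etrans (cder_sum oO _ _ hd sF Ox) _.
  (* The first sum is C_{l rbar h | 0}, which vanishes; the second, from d eta^i / d eta^h, leaves
     f_h. *)
  transitivity (\sum_i cartan_h L l r h i x * y i x +
      \sum_i (i == h)%:R * metric_hol_h l r i x).
    rewrite -big_split; apply: eq_bigr => i _.
    apply: etrans (cderM hd (smooth_metric_hol_h l r i) (smooth_coord oU i) Ox) _.
    by rewrite d_eta_coord d_eta_metric_hol_h // [metric_hol_h _ _ _ _ * _]mulrC.
  by rewrite sum_delta; have := h0 h x Ox; rewrite /cartan_h0 => ->; exact: add0r.
have phi_etabar x : O x -> d_etabar k phi x = 0.
  move=> Ox; have hd := d_etabar_cder k.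
  apply: etrans (cder_sum oO _ _ hd sF Ox) _.
  transitivity ((cartan_hbar0 L r l k x)^*); last by rewrite hbar0 // conjC0.
  rewrite conj_sum; apply: eq_bigr => i _.
  apply: etrans (cderM0 hd (smooth_metric_hol_h l r i) (smooth_coord oU i) Ox
    (d_etabar_coord k i x)) _.
  by rewrite conjM conjCK d_etabar_metric_hol_h.
rewrite -(eq_cder oO (d_etabar_cder k) (smooth_d_eta s sphi) (phi_eta s) Oq).
rewrite (cderC oO (d_etabar_cder k) (d_eta_cder s) sphi Oq).
exact: (cder_eq0 (d_eta_cder s) phi_etabar Oq).
Qed.

End holomorphic_spray.

(** * The cycle of implications in one chart *)

Lemma landsberg_metric_h :
  (forall l r h q, O q -> cartan_h0 L l r h q = 0) ->
  (forall j r h q, O q -> cartan_hbar0 L j r h q = 0) ->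
  (forall l r s, exists f : 'rV[C]_n -> C, forall z eta, O (z, eta) ->
     metric_h L l r s (z, eta) = f z) /\
  (forall h i q, O q -> d_etabar h (spray L i) q = 0).
Proof.
move=> h0 hbar0.
have hol h i q (Oq : O q) : d_etabar h (spray L i) q = 0.
  by apply: spray_holomorphic => // j r k; exact: hbar0.
split => // l r s.
have hbar := metric_hol_h_holomorphic hol (h0 l r) (hbar0 r l).
have sm := smooth_metric_hol_h l r s.
have heta := holomorphic_degree0 oU sm (homogeneous_metric_hol_h l r s)
  (fun k => hbar k s).
(* The function of z is the value at a chosen point of the slit fibre; the default 0 is taken only
   over an empty fibre, where nothing is claimed. *)
exists (fun z => metric_hol_h l r s (z, xget 0 [set eta | O (z, eta)])) => z eta Oq.
apply: etrans (metric_hE hol l r s Oq) _.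
apply: (fibrewise_constant oU sm heta (fun k => hbar k s) Oq).
have Ez : exists x, [set x | O (z, x)] x by exists eta.
exact: (xgetPex 0 Ez).
Qed.

Lemma metric_h_base_cartan_h :
  (forall l r s, exists f : 'rV[C]_n -> C, forall z eta, O (z, eta) ->
     metric_h L l r s (z, eta) = f z) ->
  (forall h i q, O q -> d_etabar h (spray L i) q = 0) ->
  forall l r h k q, O q -> cartan_h L l r h k q = 0.
Proof.
move=> hf hol l r h k q Oq; have [f fE] := hf l r k.
rewrite -(d_eta_metric_hol_h hol) // -(d_eta_base f h q).
apply: (eq_cder oO (d_eta_cder h)) => //; first exact: smooth_metric_hol_h.
by move=> [z eta] Oz; rewrite -(metric_hE hol) // fE.
Qed.

Lemma cartan_h_cartan_hbar :
  (forall l r h k q, O q -> cartan_h L l r h k q = 0) ->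
  (forall h i q, O q -> d_etabar h (spray L i) q = 0) ->
  forall j r h k q, O q -> cartan_hbar L j r h k q = 0.
Proof.
move=> hc hol j r h k q Oq; apply: (can_inj (@conjCK _)).
rewrite conjC0 -(d_etabar_metric_hol_h hol) //.
apply: (antiholomorphic_degree0 oU (smooth_metric_hol_h r j k)) => //.
  exact: homogeneous_metric_hol_h.
by move=> i x Ox; rewrite (d_eta_metric_hol_h hol) // hc.
Qed.

Lemma cartan_hbar_landsberg :
  (forall j r h k q, O q -> cartan_hbar L j r h k q = 0) ->
  (forall l r h q, O q -> cartan_h0 L l r h q = 0) /\
  (forall j r h q, O q -> cartan_hbar0 L j r h q = 0).
Proof.
move=> hc.
have hbar0 j r h q : O q -> cartan_hbar0 L j r h q = 0.
  by move=> Oq; apply: big_mul0 => k; exact: hc.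
split => // l r h q Oq.
have hol k i x (Ox : O x) : d_etabar k (spray L i) x = 0.
  by apply: spray_holomorphic => // j r' h'; exact: hbar0.
apply: big_mul0 => k; rewrite -(d_eta_metric_hol_h hol) //.
apply: (holomorphic_degree0 oU (smooth_metric_hol_h l r k)) => //.
  exact: homogeneous_metric_hol_h.
by move=> i x Ox; rewrite (d_etabar_metric_hol_h hol) // hc // conjC0.
Qed.
End local_finsler.

(** * Charts of a complex Finsler space as instances of the local setting *)

Section finsler_charts.
Variables (R : realType) (n : nat) (M : complexFinslerSpace R n).
Variable a : cm_index M.
Local Notation U := (cm_img a).

Lemma cf_L_real q : (cf_L a q)^* = cf_L a q.
Proof. by apply: cplxP; rewrite ReIm //= oppr0. Qed.

Lemma cf_L_homogeneous : homogeneous_as U (fun la => la * la^*) (cf_L a).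
Proof.
move=> z eta la la0 [/= Uz _]; rewrite /cf_L /local_L !expr2 !ofRM.
by rewrite cf_homogeneous // mulrACA -expr2 normCK.
Qed.

End finsler_charts.

Theorem theorem3p3 (R : realType) (n : nat) (M : complexFinslerSpace R n) :
  [<-> strong_landsberg M ;
       (forall (a : cm_index M) (l r s : 'I_n),
          exists f : 'rV[Cplx R]_n -> Cplx R,
          forall z eta, local_slit_T a (z, eta) ->
            metric_h (cf_L a) l r s (z, eta) = f z) /\
       (forall (a : cm_index M) q (h i : 'I_n), local_slit_T a q ->
          d_etabar h (spray (cf_L a) i) q = 0) ;
       (forall (a : cm_index M) q (l r h k : 'I_n), local_slit_T a q ->
          cartan_h (cf_L a) l r h k q = 0) /\
       (forall (a : cm_index M) q (h i : 'I_n), local_slit_T a q ->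
          d_etabar h (spray (cf_L a) i) q = 0) ;
       forall (a : cm_index M) q (j r h k : 'I_n), local_slit_T a q ->
          cartan_hbar (cf_L a) j r h k q = 0 ].
Proof.
have oU (a : cm_index M) : open (cm_img a) by exact: cm_img_open.
have sL (a : cm_index M) : smooth_on (slit (cm_img a)) (cf_L a) by exact: cf_smooth.
have pL (a : cm_index M) q : slit (cm_img a) q -> forall xi : 'rV[Cplx R]_n,
    xi != 0 -> 0 < \sum_i \sum_j metric (cf_L a) i j q * xi 0 i * (xi 0 j)^*.
  exact: cf_posdef.
have hL (a : cm_index M) := @cf_L_homogeneous R n M a.
have rL (a : cm_index M) := @cf_L_real R n M a.
tfae.
- move=> [h0 hbar0].
  have F a := landsberg_metric_h (oU a) (sL a) (rL a) (hL a) (pL a)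
    (fun l r h q => @h0 a q l r h) (fun j r h q => @hbar0 a q j r h).
  split=> [a l r s|a q h i Oq]; first exact: (F a).1 l r s.
  exact: (F a).2 h i q Oq.
- move=> [hf hol]; split=> // a q l r h k Oq.
  have F := metric_h_base_cartan_h (oU a) (sL a) (hL a) (pL a) (hf a)
    (fun h i q => @hol a q h i).
  exact: F.
- move=> [hc hol] a q j r h k Oq.
  have F := cartan_h_cartan_hbar (oU a) (sL a) (rL a) (hL a) (pL a)
    (fun l r h k q => @hc a q l r h k) (fun h i q => @hol a q h i).
  exact: F.
- move=> hc.
  have F a := cartan_hbar_landsberg (oU a) (sL a) (rL a) (hL a) (pL a)
    (fun j r h k q => @hc a q j r h k).
  split=> a q j r h Oq; first exact: (F a).1 j r h q Oq.
  exact: (F a).2 j r h q Oq.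
Qed.
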